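(* Let $G$ be a finite group, let $A\subseteq G$ be nonempty, and set $d=\max\{\operatorname{VC}^\ell_A(A),\operatorname{VC}^r_A(A)\}$ and $\alpha=|A|/|G|$. Then for every $\epsilon\in(0,1)$ there is a Bohr neighborhood $B\subseteq \operatorname{St}^r_\epsilon(A)$ in $G$ of complexity $O_{d,\alpha,\epsilon}(1)$ satisfying: (i) (structure) there is a set $F\subseteq A$ with $|F|\leq O_{d,\alpha,\epsilon}(1)$ such that $|A\,\triangle\, FB|<\epsilon|A|$; (ii) (regularity) $|Z^\ell_\epsilon(A,B)|\leq \epsilon|A|$.
   Context: For a group $G$ and $A,B\subseteq G$: $AB=\{ab:a\in A,b\in B\}$, $A^{-1}=\{a^{-1}:a\in A\}$, $\triangle$ is symmetric difference. A set system $\mathcal F$ on a set $X$ shatters $Y\subseteq X$ if $\{Y\cap S:S\in\mathcal F\}$ is the full power set of $Y$; $\operatorname{VC}(\mathcal F)$ is the maximum size of a finite set shattered by $\mathcal F$ ($\infty$ if unbounded). $\operatorname{VC}^\ell_B(A)=\operatorname{VC}(\{xA:x\in B\})$ and $\operatorname{VC}^r_B(A)=\operatorname{VC}(\{Ax:x\in B\})$. For finite $A$ and $N>0$, $\operatorname{Stab}^r_N(A)=\{x\in G:|Ax\triangle A|\leq N\}$, and $\operatorname{St}^r_\epsilon(A)=\operatorname{Stab}^r_{\epsilon|A|}(A)$. For finite $A,X\subseteq G$, $Z^\ell_\epsilon(A,X)=\{g\in G:\min\{|gX\cap A|,|gX\setminus A|\}\geq \epsilon|X|\}$. Bohr neighborhoods: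 $\mathrm U(m)$ is the complex unitary group of degree $m$ with the metric induced by the operator norm, and $\mathrm T(m)$ its subgroup of diagonal matrices. For $\delta\in(0,1)$ and positive integers $m,n$, a $(\delta,m,n)$-Bohr neighborhood in $G$ is a set of the form $\tau^{-1}(U\cap K)$, where $\tau:G\to\mathrm U(m)$ is a group homomorphism, $U$ is the open ball of radius $\delta$ around the identity in $\mathrm U(m)$, and $K$ is a normal subgroup of $\tau(G)$ with $[\tau(G):K]=n$ and $K\subseteq \mathrm T(m)$. It has complexity $c$ if $\max\{\delta^{-1},m,n\}\leq c$. Notation: $O_{d,\alpha,\epsilon}(1)$ denotes a quantity bounded by a constant depending only on $d,\alpha,\epsilon$. *)

(* Defs.v *)
From HB Require Import structures.
From mathcomp Require Import all_boot all_order all_fingroup all_algebra.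
From mathcomp Require Import complex.
From mathcomp Require Import reals.
Set Implicit Arguments. Unset Strict Implicit. Unset Printing Implicit Defensive.
Import Order.TTheory GRing.Theory Num.Theory.
Local Open Scope ring_scope.

Definition symdiff (T : finType) (A B : {set T}) : {set T} :=
  (A :\: B) :|: (B :\: A).

Definition shatters (T : finType) (fam : {set {set T}}) (Y : {set T}) : bool :=
  [forall S : {set T}, (S \subset Y) ==> [exists X in fam, Y :&: X == S]].

Definition VC (T : finType) (fam : {set {set T}}) : nat :=
  \max_(Y : {set T} | shatters fam Y) #|Y|.

Definition VCl (gT : finGroupType) (B A : {set gT}) : nat :=
  VC [set (x *: A)%g | x in B].
Definition VCr (gT : finGroupType) (B A : {set gT}) : nat :=
  VC [set (A :* x)%g | x in B].

Definition Str (R : realType) (gT : finGroupType) (eps : R) (A : {set gT})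
  : {set gT} :=
  [set x : gT | (#|symdiff (A :* x)%g A|%:R <= eps * #|A|%:R :> R)].

Definition Zl (R : realType) (gT : finGroupType) (eps : R) (A X : {set gT})
  : {set gT} :=
  [set g : gT | (eps * #|X|%:R <= Num.min (#|(g *: X)%g :&: A|%:R)
                                            (#|(g *: X)%g :\: A|%:R) :> R)].

Local Open Scope complex_scope.

Definition vnorm2 (R : realType) (m : nat) (v : 'cV[R[i]]_m) : R :=
  \sum_(j < m) (@complex.Re R (v j ord0) ^+ 2 + @complex.Im R (v j ord0) ^+ 2).

(* operator norm of M is < delta: the infimum of the admissible constants
   c >= 0 with |Mv| <= c |v| for all v is < delta, i.e. some admissible
   c is < delta *)
Definition opnorm_lt (R : realType) (m : nat) (M : 'M[R[i]]_m) (delta : R)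
  : Prop :=
  exists c : R, [/\ 0 <= c, c < delta &
    forall v : 'cV[R[i]]_m, vnorm2 (M *m v) <= c ^+ 2 * vnorm2 v].

Definition adjmx (R : realType) (m : nat) (M : 'M[R[i]]_m) : 'M[R[i]]_m :=
  (map_mx (@conjc R) M)^T.

Definition unitary (R : realType) (m : nat) (M : 'M[R[i]]_m) : Prop :=
  adjmx M *m M = 1%:M.

(* B is a (delta,m,n)-Bohr neighborhood in G = [set: gT]:
   B = tau^{-1}(U cap K), tau : G -> U(m) a homomorphism, U the open
   delta-ball around 1 in U(m) (operator norm), K a normal subgroup of
   tau(G) of index n consisting of diagonal matrices. *)
Definition bohr_nbhd (R : realType) (gT : finGroupType)
  (delta : R) (m n : nat) (B : {set gT}) : Prop :=
  [/\ 0 < delta, delta < 1, (0 < m)%N, (0 < n)%N &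
  (exists (tau : gT -> 'M[R[i]]_m) (K : pred 'M[R[i]]_m),
    (forall x, unitary (tau x)) /\
    (forall x y, tau (x * y)%g = tau x *m tau y) /\
    (forall M, K M -> exists x, tau x = M) /\
    K 1%:M /\ (forall M N, K M -> K N -> K (M *m N)) /\
    (forall M, K M -> K (invmx M)) /\
    (forall x M, K M -> K (invmx (tau x) *m M *m tau x)) /\
    (* [tau(G) : K] = n *)
    size (undup [seq tau x | x <- enum gT]) =
      (n * size (undup [seq tau x | x <- enum gT & K (tau x)]))%N /\
    (forall M, K M -> is_diag_mx M) /\
    (forall x, x \in B <-> (K (tau x) /\ opnorm_lt (tau x - 1%:M) delta)))].

Definition complexity_le (R : realType) (delta : R) (m n : nat) (c : R) : Prop :=
  [/\ delta^-1 <= c, m%:R <= c & n%:R <= c].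

(* Main.v *)
Require Import Defs.
From HB Require Import structures.
From mathcomp Require Import all_boot all_order all_fingroup all_algebra.
From mathcomp Require Import complex.
From mathcomp Require Import reals.
From mathcomp Require Import boolp.
From mathcomp Require Import zify lra ring.
Set Implicit Arguments. Unset Strict Implicit. Unset Printing Implicit Defensive.
Import Order.TTheory GRing.Theory Num.Theory.

(* Let a be the indicator function of A in C^G, with G acting by right
   translation. Since {Ax : x in A} has bounded VC dimension, Haussler-type
   packing shows that the almost-stabilizer of A has positive density.  The Gram
   operator sum_x (ax)^* (ax) commutes with the action, so its eigenvectors with
   eigenvalue at least c|G||A| span an invariant subspace, of dimension at most
   1/c by the trace formula; the component of a orthogonal to that subspace is
   small because it is almost invariant under many x.  This gives a unitary
   representation tau of bounded dimension such that tau(x) close to 1 forces x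
   to almost stabilize A.  By Jordan's commutator argument, the elements x with
   tau(x) close to 1 commute under tau, hence generate a normal subgroup K of
   bounded index on which tau is diagonalizable.
   With B_r the Bohr neighborhoods of K, pigeonhole gives radii r and k with
   |B_(r+k)| <= 2|B_r|, and B = B_k.  Regularity is a double count of pairs in
   B.  For structure, let A' be the g in A with most of g B_(r+k) inside A, and
   F a maximal subset of A' with disjoint translates g B_(k/2): then A' lies in
   FB, and a point y of FB outside A has most of y B_r inside A, which is rare. *)

(** * Packing and almost-stabilizers *)

Local Open Scope nat_scope.

Section Shattering.
Variable T : finType.
Implicit Types (F : {set {set T}}) (Y S X : {set T}).

Lemma shattersP F Y :
  reflect (forall S, S \subset Y -> exists2 X, X \in F & Y :&: X = S)
          (shatters F Y).
Proof.
apply: (iffP forallP) => [h S SY | h S].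
  have /existsP[X /andP[XF /eqP <-]] := implyP (h S) SY.
  by exists X.
apply/implyP => /h[X XF <-]; apply/existsP; exists X; by rewrite XF eqxx.
Qed.

Lemma shatters_sub F F' Y : F \subset F' -> shatters F Y -> shatters F' Y.
Proof.
move=> /subsetP FF' /shattersP h; apply/shattersP => S /h[X XF <-].
by exists X; first exact: FF'.
Qed.

Lemma leq_VC F Y : shatters F Y -> #|Y| <= VC F.
Proof. by move=> sY; apply: (leq_bigmax_cond (F := fun Z : {set T} => #|Z|)). Qed.

Lemma VC_mono F F' : F \subset F' -> VC F <= VC F'.
Proof.
move=> FF'; apply/bigmax_leqP => Y /(shatters_sub FF') sY.
exact: leq_VC.
Qed.

(* Pajor: split [F] by membership of a point [x] separating two members; a set
   shattered by both halves can be enlarged by [x]. *)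
Lemma pajor F : #|F| <= #|[set Y | shatters F Y]|.
Proof.
elim: {F}_.+1 {-2}F (ltnSn #|F|) => // n IH F; rewrite ltnS => leFn.
have [/card_le1P F1|] := boolP (#|F| <= 1).
  have [->|[X XF]] := set_0Vmem F; first by rewrite cards0.
  rewrite (_ : F = [set X]); last first.
    by apply/setP => Y; rewrite (F1 _ XF) !inE.
  rewrite cards1 card_gt0; apply/set0Pn; exists set0; rewrite inE.
  apply/shattersP => S; rewrite subset0 => /eqP->; exists X; rewrite ?set11 //.
  by rewrite set0I.
rewrite -ltnNge => /card_gt1P[X1 [X2 [X1F X2F X12]]].
have [x xX12] : exists x, (x \in X1) != (x \in X2).
  apply/existsP; apply: contraNT X12 => /existsPn h; apply/eqP/setP => x.
  by apply/eqP; rewrite -[_ == _]negbK h.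
pose F1 := [set X in F | x \in X]; pose F0 := [set X in F | x \notin X].
have cF : #|F| = #|F1| + #|F0|.
  rewrite -cardsUI (_ : F1 :&: F0 = set0) ?cards0 ?addn0.
    by congr #|pred_of_set _|; apply/setP => X; rewrite !inE; do 2 case: (_ \in _).
  by apply/setP => X; rewrite !inE; case: (x \in X); rewrite ?andbF.
have [F1_gt0 F0_gt0] : 0 < #|F1| /\ 0 < #|F0|.
  case xX1: (x \in X1) xX12; case xX2: (x \in X2) => // _;
    split; rewrite card_gt0; apply/set0Pn;
    [exists X1 | exists X2 | exists X2 | exists X1];
    by rewrite inE ?X1F ?X2F ?xX1 ?xX2.
have h1 : #|F1| <= #|[set Y | shatters F1 Y]| by apply: IH; lia.
have h0 : #|F0| <= #|[set Y | shatters F0 Y]| by apply: IH; lia.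
set s1 := [set Y | _] in h1; set s0 := [set Y | _] in h0.
have xs1 Y : Y \in s1 -> x \notin Y.
  rewrite inE => /shattersP/(_ set0 (sub0set _))[X]; rewrite inE => /andP[_ xX] YX.
  by apply: contra_eqN YX => xY; apply/set0Pn; exists x; rewrite inE xY.
have xs0 Y : Y \in s0 -> x \notin Y.
  rewrite inE => /shattersP/(_ Y (subxx _))[X]; rewrite inE => /andP[_ xX] YX.
  by apply: contra xX => xY; rewrite -YX inE in xY; case/andP: xY.
have sub1 : s1 :|: s0 \subset [set Y | shatters F Y].
  apply/subsetP => Y; rewrite !inE => /orP[]; apply: shatters_sub;
  by apply/subsetP => X; rewrite inE => /andP[].
have sub2 : [set x |: Y | Y in s1 :&: s0] \subset [set Y | shatters F Y].
  apply/subsetP => _ /imsetP[Y /setIP[Y1 Y0] ->]; rewrite inE.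
  have xY := xs1 _ Y1.
  move: Y1 Y0; rewrite !inE => /shattersP Y1 /shattersP Y0.
  apply/shattersP => S SY.
  have SxY : S :\ x \subset Y by rewrite subDset.
  have [xS|xS] := boolP (x \in S).
    have [X] := Y1 _ SxY; rewrite inE => /andP[XF xX] E; exists X => //.
    by rewrite setIUl E (setIidPl _) ?sub1set // setD1K.
  have [X] := Y0 _ SxY; rewrite inE => /andP[XF xX] E; exists X => //.
  rewrite setIUl E (_ : [set x] :&: X = set0) ?set0U.
    by apply/setDidPl; rewrite disjoint_sym disjoints1.
  by apply/setP => y; rewrite !inE; case: eqP => // ->; apply: negbTE.
have inj2 : {in s1 :&: s0 &, injective (fun Y => x |: Y)}.
  move=> Y Y' /setIP[/xs1 xY _] /setIP[/xs1 xY' _] /(congr1 (fun Z => Z :\ x)).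
  by rewrite !setU1K.
have dis : (s1 :|: s0) :&: [set x |: Y | Y in s1 :&: s0] = set0.
  apply/setP => Z; rewrite in_setI in_set0; apply/negbTE/negP.
  by case/andP => /setUP ZU /imsetP[Y _ E]; case: ZU => [/xs1|/xs0]; rewrite E setU11.
have : #|(s1 :|: s0) :|: [set x |: Y | Y in s1 :&: s0]| <= #|[set Y | shatters F Y]|.
  by apply: subset_leq_card; rewrite subUset sub1 sub2.
rewrite cardsU dis cards0 subn0 (card_in_imset inj2).
rewrite cardsUI; lia.
Qed.

(** A set of size at most [d] is the set of values of some map from ['I_d] to [option T], with
    [None] as padding. This crude count suffices because it is only compared with an exponential. *)
Lemma card_small_sets d : #|[set Y : {set T} | #|Y| <= d]| <= (#|T|.+1) ^ d.
Proof.
pose g (f : {ffun 'I_d -> option T}) := [set x | Some x \in codom f].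
have -> : #|T|.+1 ^ d = #|{: {ffun 'I_d -> option T}}|.
  by rewrite card_ffun card_option card_ord.
apply: leq_trans (leq_imset_card g _); apply: subset_leq_card.
apply/subsetP => Y; rewrite inE => Yd; apply/imsetP.
exists [ffun i : 'I_d => nth None [seq Some x | x <- enum Y] i] => //.
apply/setP => x; rewrite inE; apply/idP/codomP => [xY|[j]].
  have xi : index x (enum Y) < #|Y| by rewrite cardE index_mem mem_enum.
  exists (Ordinal (leq_trans xi Yd)); rewrite ffunE /= (nth_map x) -?cardE //.
  by rewrite nth_index // mem_enum.
rewrite ffunE => E.
have [li|li] := ltnP j (size (enum Y)).
  by move: E; rewrite (nth_map x) // => -[->]; rewrite -mem_enum mem_nth.
by rewrite nth_default ?size_map // in E.
Qed.

Lemma sauer_shelah F d : VC F <= d -> #|F| <= (#|T|.+1) ^ d.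
Proof.
move=> vc; apply: leq_trans (pajor F) (leq_trans _ (card_small_sets d)).
apply: subset_leq_card; apply/subsetP => Y; rewrite !inE => sY.
exact: leq_trans (leq_VC sY) vc.
Qed.

End Shattering.

(** Preimages cannot tell apart two indices with the same image, so [t] is injective on a shattered
    index set, and the image of that set is shattered by [F]. *)
Lemma VC_preim (I T : finType) (t : I -> T) (F : {set {set T}}) :
  VC [set t @^-1: X | X : {set T} in F] <= VC F.
Proof.
apply/bigmax_leqP => Y /shattersP h.
have tinj : {in Y &, injective t}.
  move=> i j iY jY tij; have /h[_ /imsetP[X _ ->] E] : [set i] \subset Y by rewrite sub1set.
  have : i \in [set i] by rewrite set11.
  rewrite -E !inE iY /= tij => tjX.
  have /set1P-> // : j \in [set i] by rewrite -E !inE jY.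
rewrite -(card_in_imset tinj).
apply/leq_VC/shattersP => S SY.
have /h[_ /imsetP[X XF ->] E] : Y :&: t @^-1: S \subset Y by apply: subsetIl.
exists X => //; apply/setP => y; rewrite inE.
apply/andP/idP => [[/imsetP[i iY ->] tiX] | yS].
  by have /setP/(_ i) := E; rewrite !inE iY tiX /=.
have /imsetP[i iY yi] := subsetP SY _ yS.
by have /setP/(_ i) := E; rewrite !inE iY /= -yi yS => ->; split=> //; rewrite yi imset_f.
Qed.

Lemma leq_expr m n k : m <= n -> m ^ k <= n ^ k.
Proof. by move=> mn; case: k => // k; rewrite leq_exp2r. Qed.

(** Bernoulli's inequality (1 + 1/p)^n >= 1 + n/p, cleared of denominators. *)
Lemma bernoulli p n : (p + n) * p ^ n <= p * p.+1 ^ n.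
Proof.
elim: n => [|n IH]; first by rewrite !expn0; lia.
rewrite !expnS; have : (p + n.+1) * p <= (p + n) * p.+1 by nia.
nia.
Qed.

(** This is (1 - 1/q)^q <= 1/2, from Bernoulli with p = q - 1 and n = q. *)
Lemma expn_half q : 0 < q -> (q.-1 ^ q) * 2 <= q ^ q.
Proof.
case: q => [|[|a]] // _; rewrite -[a.+2.-1]/a.+1.
have := bernoulli a.+1 a.+2; rewrite -(@leq_pmul2l a.+1) //.
by move: (a.+1 ^ _) (a.+2 ^ _) => b c; nia.
Qed.

(** Supplies the exponent for [packing]: 2^i sets told apart by q(2i+1) sample points are too many
    for Sauer-Shelah. *)
Lemma exp_beats_poly d q : exists i, (q * (i.*2.+1)).+1 ^ d < 2 ^ i.
Proof.
(* For i = 2^(3t) the left side is at most 2^((q+2+3t)d), whose exponent is at most 4t^2 and hence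
   below 2^(3t). *)
have [t tE] : exists t, t = d + q + 5 by exists (d + q + 5).
exists (2 ^ (3 * t)).
have lt2 n : n < 2 ^ n by apply: ltn_expl.
have b1 : (q * (2 ^ (3 * t)).*2.+1).+1 <= 2 ^ (q + 2 + 3 * t).
  rewrite (expnD 2 (q + 2)) (expnD 2 q); have := lt2 q; have : 0 < 2 ^ (3 * t) by rewrite expn_gt0.
  rewrite (_ : 2 ^ 2 = 4) //.
  move: (2 ^ q) (2 ^ (3 * t)) => a b b_gt0 qa.
  have : b + q * b <= a * b by rewrite -mulSn leq_mul2r qa orbT.
  have : q <= q * b by rewrite leq_pmulr.
  rewrite -muln2 mulnS mulnA [a * 4 * b]mulnAC.
  move: (q * b) (a * b) => u v; lia.
have b2 : (q + 2 + 3 * t) * d < 2 ^ (3 * t).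
  have := lt2 t; rewrite [3 * t]mulnC expnM; move: (2 ^ t) => a ta.
  have : (q + 2 + 3 * t) * d <= (4 * t) * t by apply: leq_mul; lia.
  have : t * t <= a * a by apply: leq_mul; apply: ltnW.
  have : a * a * 6 <= a * a * a by rewrite leq_mul2l (leq_trans _ ta) ?orbT //; lia.
  have : 0 < a * a by rewrite muln_gt0 (leq_ltn_trans _ ta).
  rewrite !expnS expn0; lia.
apply: leq_ltn_trans (_ : _ <= 2 ^ ((q + 2 + 3 * t) * d)) _; last by rewrite ltn_exp2l.
by rewrite (expnM 2 (q + 2 + 3 * t)); apply: leq_expr.
Qed.

Section Packing.
Variables (T : finType) (q : nat).
Implicit Types (F : {set {set T}}).

Definition separated F :=
  forall X Y, X \in F -> Y \in F -> X != Y -> #|T| <= #|symdiff X Y| * q.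

(* A uniformly random [k]-tuple misses a given symmetric difference with
   probability at most [(1 - 1/q)^k]; union bound over pairs. *)
Lemma sample_separates F k : 0 < q -> 0 < #|T| -> separated F ->
  #|F| ^ 2 * q.-1 ^ k < q ^ k ->
  exists t : {ffun 'I_k -> T}, {in F &, injective (fun X : {set T} => t @^-1: X)}.
Proof.
move=> q_gt0 T_gt0 sepF ltq.
pose bad (p : {set T} * {set T}) := [set t : {ffun 'I_k -> T} |
  t \in ffun_on [predC symdiff p.1 p.2]].
pose P := [set p in setX F F | p.1 != p.2].
have [t tgood | tbad] := pickP [pred t | [forall p in P, t \notin bad p]].
  exists t => X Y XF YF E; apply/eqP; apply: contraLR isT => XY.
  have /forallP/(_ (X, Y)) := tgood; rewrite !inE XF YF /= XY /=.
  move/negP; case; apply/ffun_onP => i; rewrite !inE /=.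
  by have /setP/(_ i) := E; rewrite !inE => ->; case: (t i \in Y).
have badq p : p \in P -> #|bad p| * q ^ k <= (#|T| * q.-1) ^ k.
  case: p => X Y; rewrite !inE => /andP[/andP[XF YF] XY].
  rewrite cardsE card_ffun_on card_ord -expnMn; apply: leq_expr.
  have -> : #|[predC symdiff X Y]| = #|T| - #|symdiff X Y|.
    by rewrite -(cardC (mem (symdiff X Y))) addKn; apply: eq_card.
  by rewrite mulnBl -subn1 mulnBr muln1 leq_sub2l // sepF.
have : \sum_(t : {ffun 'I_k -> T}) 1 <= \sum_(p in P) #|bad p|.
  under [X in _ <= X]eq_bigr => p _ do rewrite -sum1_card.
  rewrite (exchange_big_dep xpredT) //=; apply: leq_sum => t _.
  have /negbT := tbad t; rewrite negb_forall => /existsP[p].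
  by rewrite negb_imply negbK => /andP[pP pt]; rewrite (bigD1 p) //= pP pt.
rewrite sum1_card card_ffun card_ord => h.
have : #|T| ^ k * q ^ k <= #|P| * (#|T| * q.-1) ^ k.
  apply: leq_trans (leq_mul h (leqnn _)) _.
  by rewrite big_distrl /= -[X in _ <= X]sum_nat_const; apply: leq_sum.
have : #|P| <= #|F| ^ 2.
  rewrite -mulnn -cardsX; apply: subset_leq_card; apply/subsetP => p.
  by rewrite !inE => /andP[].
rewrite expnMn; have : 0 < #|T| ^ k by rewrite expn_gt0 T_gt0.
move: (#|T| ^ k) (q ^ k) (q.-1 ^ k) (#|F| ^ 2) #|P| ltq => a b c e f ltq a_gt0 fe h2.
have : f * (a * c) <= a * (e * c) by rewrite mulnCA leq_mul2l leq_mul2r fe !orbT.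
have : a * (e * c) < a * b by rewrite ltn_pmul2l.
lia.
Qed.

End Packing.

(** A short sample distinguishes 2^i separated sets, so their traces on it are 2^i distinct sets of
    no larger VC dimension, contradicting Sauer-Shelah by the choice of [i]. *)
Lemma packing d q : exists N, forall (T : finType) (F : {set {set T}}),
  0 < #|T| -> VC F <= d -> separated q F -> #|F| <= N.
Proof.
have [i hi] := exp_beats_poly d q; exists (2 ^ i) => T F T_gt0 vcF sepF.
rewrite leqNgt; apply/negP => ltF.
have [F0 F0F cF0] : exists2 F0 : {set {set T}}, F0 \subset F & #|F0| = 2 ^ i.
  exists [set X in take (2 ^ i) (enum F)].
    by apply/subsetP => X; rewrite inE => /mem_take; rewrite mem_enum.
  rewrite cardsE (card_uniqP _) ?take_uniq ?enum_uniq // size_take -cardE.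
  by rewrite ltF.
have F1 : 1 < #|F| by apply: leq_trans ltF; rewrite ltnS expn_gt0.
have q_gt0 : 0 < q.
  have /card_gt1P[X [Y [XF YF XY]]] := F1.
  by have := sepF X Y XF YF XY; case: (q) => //; rewrite muln0; lia.
(* With this sample size (1 - 1/q)^k <= 2^-(2i+1), which beats the |F0|^2 = 2^(2i) of the union
   bound. *)
pose k := q * i.*2.+1.
have sep0 : separated q F0.
  by move=> X Y XF YF; apply: sepF; apply: (subsetP F0F).
have ltk : #|F0| ^ 2 * q.-1 ^ k < q ^ k.
  rewrite cF0 -expnM muln2 /k !expnM.
  have h : q.-1 ^ q * 2 <= q ^ q := expn_half q_gt0.
  have : (q.-1 ^ q * 2) ^ i.*2.+1 <= (q ^ q) ^ i.*2.+1 by rewrite leq_exp2r.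
  have : 0 < (q ^ q) ^ i.*2.+1 by rewrite !expn_gt0 q_gt0.
  rewrite expnMn (expnS 2).
  move: ((q ^ q) ^ _) ((q.-1 ^ q) ^ _) (2 ^ i.*2) => a b c; nia.
have [t tinj] := sample_separates q_gt0 T_gt0 sep0 ltk.
have := sauer_shelah (leq_trans (VC_preim t F0) (leq_trans (VC_mono F0F) vcF)).
rewrite (card_in_imset tinj) cF0 card_ord.
by rewrite leqNgt hi.
Qed.

Local Open Scope ring_scope.

Section AlmostStabilizer.
Variable R : realType.

Lemma card_symdiff_rcoset (gT : finGroupType) (A B : {set gT}) x :
  #|symdiff (A :* x)%g (B :* x)%g| = #|symdiff A B|.
Proof.
rewrite -(card_rcoset (symdiff A B) x); congr #|pred_of_set _|.
by apply/setP => y; rewrite !(inE, mem_rcoset).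
Qed.

Lemma Str_rcoset (gT : finGroupType) (eta : R) (A : {set gT}) x y :
  (x * y^-1 \in Str eta A)%g = (#|symdiff (A :* x)%g (A :* y)%g|%:R <= eta * #|A|%:R).
Proof. by rewrite inE -(card_symdiff_rcoset _ _ y) -rcosetM mulgKV. Qed.

(** Take a maximal [Y] in [A] whose distinct elements have quotients outside the almost-stabilizer.
    Packing bounds |Y|, and by maximality the translates of the almost-stabilizer by [Y] cover
    [A]. *)
Lemma card_Str_lb (d : nat) (alpha eta : R) : 0 < eta ->
  exists2 N : nat, (0 < N)%N &
  forall (gT : finGroupType) (A : {set gT}), A != set0 -> (VCr A A <= d)%N ->
  #|A|%:R / #|gT|%:R = alpha -> (#|A| <= N * #|Str eta A|)%N.
Proof.
move=> eta_gt0.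
(* Translates of [A] at distance more than eta|A| = eta alpha |G| differ on at least |G|/q
   points. *)
pose q := (Num.truncn (eta * alpha)^-1).+1.
have [N hN] := packing d q; exists N.+1 => // gT A A0 vcA alphaE.
have G_gt0 : (0 < #|gT|)%N by apply/card_gt0P; exists 1%g.
have A_gt0 : 0 < #|A|%:R :> R by rewrite ltr0n card_gt0 A0.
have alpha_gt0 : 0 < alpha by rewrite -alphaE divr_gt0 // ltr0n.
pose sep (Y : {set gT}) := [forall x in Y, forall y in Y,
   (x != y) ==> (x * y^-1 \notin Str eta A)%g].
have sep0 : sep set0 && (set0 \subset A).
  by rewrite sub0set andbT; apply/forall_inP => x; rewrite inE.
have [Y /maxsetP[/andP[sepY YA] maxY] _] := @maxset_exists _ (fun Y => sep Y && (Y \subset A)) _ sep0.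
have sepYP x y : x \in Y -> y \in Y -> x != y -> (x * y^-1)%g \notin Str eta A.
  by move=> xY yY xy; have /forall_inP/(_ x xY)/forall_inP/(_ y yY)/implyP/(_ xy) := sepY.
have Str1 : 1%g \in Str eta A.
  by rewrite -(mulgV 1%g) Str_rcoset /symdiff setDv setU0 cards0 mulr_ge0 ?ltW.
have injY : {in Y &, injective (fun x => A :* x)%g}.
  move=> x y xY yY E; apply/eqP; apply: contraLR isT => /(sepYP _ _ xY yY).
  by rewrite Str_rcoset E /symdiff setDv setU0 cards0 mulr_ge0 // ltW.
have cY : (#|Y| <= N)%N.
  rewrite -(card_in_imset injY); apply: hN => //.
    by apply: leq_trans vcA; apply: VC_mono; apply: imsetS.
  move=> _ _ /imsetP[x xY ->] /imsetP[y yY ->] xy.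
  have /(sepYP _ _ xY yY) : x != y by apply: contraNneq xy => ->.
  rewrite Str_rcoset -ltNge => h.
  rewrite -(ler_nat R) natrM.
  have hq : (eta * alpha)^-1 < q%:R by rewrite /q truncnS_gt.
  have ea : 0 < eta * alpha by rewrite mulr_gt0.
  apply: (@le_trans _ _ (eta * #|A|%:R * q%:R)); last first.
    by rewrite ler_wpM2r // ltW.
  rewrite (_ : #|A|%:R = alpha * #|gT|%:R); last first.
    by rewrite -alphaE divfK // pnatr_eq0 -lt0n.
  rewrite mulrA mulrAC ler_peMl //.
  by rewrite -ler_pdivrMl // mulr1 ltW.
have AU : A \subset \bigcup_(y in Y) (Str eta A :* y)%g.
  apply/subsetP => x xA; apply/bigcupP.
  have [/existsP[y /andP[yY xy]]|/existsPn h] :=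
    boolP [exists y, (y \in Y) && (x * y^-1 \in Str eta A)%g].
    by exists y => //; rewrite mem_rcoset.
  exists x; last by rewrite mem_rcoset mulgV Str1.
  have h' y : y \in Y -> (x * y^-1)%g \notin Str eta A.
    by move=> yY; have := h y; rewrite yY.
  have h'' y : y \in Y -> (y * x^-1)%g \notin Str eta A.
    move=> /h'; rewrite !Str_rcoset; congr (~~ (_ <= _)); congr (_%:R).
    by rewrite /symdiff setUC.
  rewrite -(maxY (x |: Y)) ?setU11 ?subsetUr // subUset sub1set xA YA !andbT.
  apply/forall_inP => a /setU1P aY; apply/forall_inP => b /setU1P bY.
  apply/implyP; case: aY bY => [->|aY] [->|bY] //.
  - by rewrite eqxx.
  - by move=> _; apply: h'.
  - by move=> _; apply: h''.
  - by apply: sepYP.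
apply: leq_trans (subset_leq_card AU) _.
apply: leq_trans (_ : _ <= \sum_(y in Y) #|Str eta A|)%N _.
  apply: (big_ind2 (fun (S : {set gT}) n => #|S| <= n)%N); first by rewrite cards0.
    by move=> S1 n1 S2 n2 h1 h2; apply: leq_trans (leq_card_setU _ _) (leq_add h1 h2).
  by move=> y _; rewrite card_rcoset.
by rewrite sum_nat_const leq_mul2r (leq_trans cY) ?orbT.
Qed.
End AlmostStabilizer.

(** * Double counting with translates *)

Section DoubleCounting.
Variable gT : finGroupType.
Implicit Types (A B X Y : {set gT}).

Lemma card_lcosetI g B Y : #|(g *: B)%g :&: Y| = (\sum_(b in B) (g * b \in Y)%g)%N.
Proof.
have -> : (g *: B)%g :&: Y = (g *: [set b in B | (g * b)%g \in Y])%g.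
  by apply/setP => x; rewrite !(inE, mem_lcoset) mulKVg.
by rewrite card_lcoset -sum1dep_card big_mkcondr.
Qed.

Lemma sum_card_lcosetI X Y B :
  (\sum_(g in X) #|(g *: B)%g :&: Y| = \sum_(b in B) #|X :&: (Y :* b^-1)%g|)%N.
Proof.
under eq_bigr => g _ do rewrite card_lcosetI.
rewrite exchange_big /=; apply: eq_bigr => b _.
rewrite -big_mkcondr /= sum1dep_card; congr #|pred_of_set _|.
by apply/setP => g; rewrite !inE mem_rcoset invgK.
Qed.

(** Both sides count the triples (g, b, c) with b, c in [B], gb in [A] and gc outside [A]. *)
Lemma sum_card_lcosetI_lcosetD A B :
  (\sum_g #|(g *: B)%g :&: A| * #|(g *: B)%g :\: A|
   = \sum_(b in B) \sum_(c in B) #|(A :* b^-1)%g :\: (A :* c^-1)%g|)%N.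
Proof.
transitivity (\sum_g \sum_(b in B) \sum_(c in B) (g * b \in A)%g * (g * c \notin A)%g)%N.
  apply: eq_bigr => g _; rewrite setDE !card_lcosetI big_distrl /=.
  apply: eq_bigr => b _; rewrite big_distrr /=.
  by apply: eq_bigr => c _; rewrite inE.
rewrite exchange_big /=; apply: eq_bigr => b _.
rewrite exchange_big /=; apply: eq_bigr => c _.
under eq_bigr => g _ do rewrite mulnb.
rewrite -big_mkcond /= sum1dep_card; congr #|pred_of_set _|.
by apply/setP => g; rewrite !inE !mem_rcoset !invgK andbC.
Qed.

End DoubleCounting.

Section BohrStructure.
Variables (R : realType) (gT : finGroupType) (A : {set gT}) (eta : R).
Implicit Types (B : {set gT}).

(** Each g in [Zl eps A B] contributes at least eps^2 |B|^2 to the sum of |gB meet A| |gB minus A|,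
    while in the double count each of the |B|^2 pairs (b, c) contributes at most eta|A|. *)
Lemma card_Zl_le (eps : R) B : 0 < eps -> B != set0 ->
  (forall b c, b \in B -> c \in B -> (b^-1 * c)%g \in Str eta A) ->
  eps ^+ 2 * #|Zl eps A B|%:R <= eta * #|A|%:R.
Proof.
move=> eps_gt0 B0 hB.
have B_gt0 : 0 < #|B|%:R :> R by rewrite ltr0n card_gt0.
rewrite -(ler_pM2l (exprn_gt0 2 B_gt0)).
apply: (@le_trans _ _ (\sum_(g in Zl eps A B)
    (#|(g *: B)%g :&: A| * #|(g *: B)%g :\: A|)%:R)).
  rewrite mulrA -exprMn mulrC mulr_natl -sumr_const; apply: ler_sum => g.
  rewrite inE le_min => /andP[h1 h2]; rewrite natrM expr2 [_ * eps]mulrC.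
  by apply: ler_pM; rewrite // mulr_ge0 ?ltW.
rewrite -natr_sum.
apply: (@le_trans _ _ (\sum_g (#|(g *: B)%g :&: A| * #|(g *: B)%g :\: A|))%:R).
  by rewrite ler_nat [leqRHS](bigID (mem (Zl eps A B))) /= leq_addr.
rewrite sum_card_lcosetI_lcosetD natr_sum.
rewrite expr2 -mulrA mulr_natl -sumr_const; apply: ler_sum => b bB.
rewrite natr_sum mulr_natl -sumr_const; apply: ler_sum => c cB.
have := hB b c bB cB; rewrite -[c in X in X -> _]invgK Str_rcoset.
by apply: le_trans; rewrite ler_nat subset_leq_card // subsetUl.
Qed.

Lemma sum_lcosetI_le X Y B :
  (forall b, b \in B -> #|X :&: (Y :* b^-1)%g|%:R <= eta * #|A|%:R) ->
  \sum_(g in X) #|(g *: B)%g :&: Y|%:R <= #|B|%:R * (eta * #|A|%:R).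
Proof.
by move=> h; rewrite -natr_sum sum_card_lcosetI natr_sum mulr_natl -sumr_const; apply: ler_sum.
Qed.

Lemma card_markov (X : {set gT}) (f : gT -> nat) (c s : R) :
  \sum_(g in X) (f g)%:R <= s ->
  #|[set g in X | c <= (f g)%:R]|%:R * c <= s.
Proof.
apply: le_trans; rewrite mulr_natl -sumr_const.
rewrite [leRHS](bigID (fun g => c <= (f g)%:R)) /=.
apply: (@le_trans _ _ (\sum_(g in X | c <= (f g)%:R) (f g)%:R)); last first.
  by rewrite lerDl sumr_ge0.
rewrite [leLHS](eq_bigl (fun g => (g \in X) && (c <= (f g)%:R))).
  by apply: ler_sum => g /andP[].
by move=> g; rewrite inE.
Qed.

(** For a maximal family of disjoint translates g Bh with g in A', every a Bh with a in A' meets one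
    of them, which puts a in g Bh Bh^-1, inside gB. Disjointness bounds the number of translates. *)
Lemma packing_translates (A' B Bh : {set gT}) : 1%g \in Bh ->
  (forall x y, x \in Bh -> y \in Bh -> (x * y^-1)%g \in B) ->
  exists2 F : {set gT}, F \subset A' &
    (#|F| * #|Bh| <= #|gT|)%N /\ A' \subset (F * B)%g.
Proof.
move=> Bh1 hB.
pose dis (F : {set gT}) := [forall g in F, forall h in F,
   (g != h) ==> ((g *: Bh)%g :&: (h *: Bh)%g == set0)].
have dis0 : dis set0 && (set0 \subset A').
  by rewrite sub0set andbT; apply/forall_inP => x; rewrite inE.
have [F /maxsetP[/andP[disF FA] maxF] _] :=
  @maxset_exists _ (fun F => dis F && (F \subset A')) _ dis0.
have disP g h : g \in F -> h \in F -> g != h -> (g *: Bh)%g :&: (h *: Bh)%g = set0.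
  by move=> gF hF gh; apply/eqP; have /forall_inP/(_ g gF)/forall_inP/(_ h hF)/implyP/(_ gh) := disF.
exists F => //; split.
  rewrite -cardsX -(@card_in_imset _ _ (fun p : gT * gT => p.1 * p.2)%g) ?max_card //.
  move=> [g x] [h y] /setXP[/= gF xB] /setXP[/= hF yB] E.
  have [gh|gh] := eqVneq g h; first by move: E; rewrite gh => /mulgI->.
  have /setP/(_ (g * x)%g) := disP g h gF hF gh.
  by rewrite !inE !mem_lcoset mulKg xB E mulKg yB.
apply/subsetP => a aA.
have [/existsP[g /andP[gF ga]]|/existsPn h] :=
  boolP [exists g, (g \in F) && ((g *: Bh)%g :&: (a *: Bh)%g != set0)].
  have /set0Pn[z] := ga; rewrite inE !mem_lcoset => /andP[zg za].
  apply/mulsgP; exists g (g^-1 * z * (a^-1 * z)^-1)%g => //; first exact: hB.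
  by rewrite invMg invgK !mulgA mulgV mul1g mulgV mul1g.
have dFa g : g \in F -> (g *: Bh)%g :&: (a *: Bh)%g = set0.
  by move=> gF; apply/eqP; have := h g; rewrite gF negbK.
have aF : a \in F.
  rewrite -(maxF (a |: F)) ?setU11 ?subsetUr // subUset sub1set aA FA !andbT.
  apply/forall_inP => x /setU1P xF; apply/forall_inP => y /setU1P yF.
  apply/implyP; case: xF yF => [->|xF] [->|yF] //.
  - by rewrite eqxx.
  - by rewrite setIC dFa.
  - by rewrite dFa.
  - by move=> xy; rewrite disP.
by apply/mulsgP; exists a 1%g; rewrite ?mulg1 // -(mulgV 1%g) hB.
Qed.

(** [B], [Br], [Brk] and [Bh] stand for Bohr sets of radii k, r, r+k and k/2. The constant 6 is 4
    from [bad] plus 2 from [bad'], both bounded by Markov's inequality. *)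
Lemma bohr_structure (B Br Brk Bh : {set gT}) :
  1%g \in Bh -> Br != set0 -> (#|Brk| <= 2 * #|Br|)%N ->
  (forall x y, x \in Bh -> y \in Bh -> (x * y^-1)%g \in B) ->
  (forall x y, x \in B -> y \in Br -> (x * y)%g \in Brk) ->
  (forall x, x \in Br :|: Brk -> (x^-1)%g \in Str eta A) ->
  exists2 F : {set gT}, F \subset A &
    (#|F| * #|Bh| <= #|gT|)%N /\
    #|symdiff A (F * B)%g|%:R <= 6%:R * (eta * #|A|%:R).
Proof.
move=> Bh1 Br0 Brk2 hBh hB hStr.
have [x0 x0B] := set0Pn _ Br0.
have Br_gt0 : (0 < #|Br|)%N by apply/card_gt0P; exists x0.
have BrBrk : (#|Br| <= #|Brk|)%N.
  rewrite -(card_lcoset Br 1%g) subset_leq_card //; apply/subsetP => y.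
  rewrite mem_lcoset => yB; rewrite -(mulKVg 1%g y) hB //.
  by rewrite -(mulgV 1%g) hBh.
have Brk_gt0 : 0 < #|Brk|%:R :> R by rewrite ltr0n (leq_trans Br_gt0).
have bnd1 b : b \in Br :|: Brk -> #|A :&: ((~: A) :* b^-1)%g|%:R <= eta * #|A|%:R.
  move=> /hStr; rewrite inE; apply: le_trans; rewrite ler_nat subset_leq_card //.
  apply/subsetP => y; rewrite !inE !mem_rcoset invgK !inE => /andP[-> ->].
  by rewrite orbT.
have bnd2 b : b \in Br :|: Brk -> #|(~: A) :&: (A :* b^-1)%g|%:R <= eta * #|A|%:R.
  move=> /hStr; rewrite inE; apply: le_trans; rewrite ler_nat subset_leq_card //.
  by apply/subsetP => y; rewrite !inE !mem_rcoset invgK => /andP[-> ->].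
pose bad := [set g in A | #|Brk|%:R / 4%:R <= #|(g *: Brk)%g :&: ~: A|%:R :> R].
have cbad : #|bad|%:R <= 4%:R * (eta * #|A|%:R).
  have := card_markov (#|Brk|%:R / 4%:R)
    (sum_lcosetI_le (fun b bB => bnd1 b (subsetP (subsetUr _ _) b bB))).
  by rewrite -/bad mulrCA ler_pM2l // ler_pdivrMr // mulrC.
pose bad' := [set g in ~: A | #|Br|%:R / 2%:R <= #|(g *: Br)%g :&: A|%:R :> R].
have cbad' : #|bad'|%:R <= 2%:R * (eta * #|A|%:R).
  have := card_markov (#|Br|%:R / 2%:R)
    (sum_lcosetI_le (fun b bB => bnd2 b (subsetP (subsetUl _ _) b bB))).
  by rewrite -/bad' mulrCA ler_pM2l ?ltr0n // ler_pdivrMr // mulrC.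
have [F FA [cF covF]] := @packing_translates (A :\: bad) _ _ Bh1 hBh.
exists F; first exact: subset_trans FA (subsetDl _ _).
split=> //.
have sub1 : A :\: (F * B)%g \subset bad.
  apply/subsetP => a /setDP[aA aFB]; apply: contraNT aFB => abad.
  by apply: (subsetP covF); rewrite inE abad.
have sub2 : (F * B)%g :\: A \subset bad'.
  apply/subsetP => _ /setDP[/mulsgP[g b gF bB ->] gbA].
  rewrite !inE gbA /=.
  have := subsetP FA g gF; rewrite !inE => /andP[+ gA]; rewrite gA /= -ltNge => hg.
  (* Since b Br lies in [Brk], fewer than |Brk|/4 <= |Br|/2 points of gb Br fall outside [A], so at
     least half of gb Br lies in [A]. *)
  have c1 : (#|(g * b *: Br)%g :&: ~: A| <= #|(g *: Brk)%g :&: ~: A|)%N.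
    apply: subset_leq_card; apply: setSI; apply/subsetP => y.
    rewrite !mem_lcoset invMg -mulgA => yB.
    by rewrite -(mulKVg b (g^-1 * y)%g) hB.
  have c2 : (#|(g * b *: Br)%g :&: A| + #|(g * b *: Br)%g :&: ~: A| = #|Br|)%N.
    by rewrite -setDE cardsID card_lcoset.
  move: c1 Brk2 hg; rewrite -c2 -!(ler_nat R) !(natrM, natrD).
  move: (#|_|%:R : R) (#|_|%:R : R) (#|_|%:R : R) (#|_|%:R : R) => u v w z; lra.
rewrite (le_trans (_ : _ <= (#|bad| + #|bad'|)%:R)) //; last by rewrite natrD; lra.
rewrite ler_nat (leq_trans (leq_card_setU _ _)) // leq_add // subset_leq_card //.
Qed.

End BohrStructure.

(** * The Frobenius norm *)

Local Open Scope sesquilinear_scope.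

Section Frobenius.
Variable C : numClosedFieldType.

Lemma adjM m n p (A : 'M[C]_(m, n)) (B : 'M[C]_(n, p)) :
  (A *m B)^t* = B^t* *m A^t*.
Proof. by rewrite trmx_mul map_mxM. Qed.

Lemma adjD m n (A B : 'M[C]_(m, n)) : (A + B)^t* = A^t* + B^t*.
Proof. by rewrite linearD map_mxD. Qed.

Lemma adjB m n (A B : 'M[C]_(m, n)) : (A - B)^t* = A^t* - B^t*.
Proof. by rewrite linearB map_mxB. Qed.

Lemma adj1 n : (1%:M : 'M[C]_n)^t* = 1%:M.
Proof. by rewrite trmx1 map_mx1. Qed.

Definition mxdot m n (A B : 'M[C]_(m, n)) := \tr (A *m B^t*).
(** The squared Frobenius norm; keeping it squared avoids square roots in the estimates. *)
Definition nsq m n (A : 'M[C]_(m, n)) := mxdot A A.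

Lemma mxdotE m n (A B : 'M[C]_(m, n)) :
  mxdot A B = \sum_i \sum_j A i j * (B i j)^*.
Proof.
by apply: eq_bigr => i _; rewrite mxE; apply: eq_bigr => j _; rewrite !mxE.
Qed.

Lemma nsqE m n (A : 'M[C]_(m, n)) : nsq A = \sum_i \sum_j `|A i j| ^+ 2.
Proof.
by rewrite /nsq mxdotE; apply: eq_bigr => i _; apply: eq_bigr => j _; rewrite normCK.
Qed.

Lemma nsq_ge0 m n (A : 'M[C]_(m, n)) : 0 <= nsq A.
Proof. by rewrite nsqE; do 2!apply: sumr_ge0 => ? _; rewrite exprn_ge0. Qed.

Lemma nsq_eq0 m n (A : 'M[C]_(m, n)) : (nsq A == 0) = (A == 0).
Proof.
apply/eqP/eqP => [|->]; last by rewrite /nsq /mxdot mul0mx mxtrace0.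
rewrite nsqE => /psumr_eq0P h; apply/matrixP => i j; rewrite mxE.
have /psumr_eq0P/(_ j isT) := h (fun k _ => sumr_ge0 _ (fun l _ => exprn_ge0 2 (normr_ge0 (A k l)))) i isT.
move=> /(_ (fun l _ => exprn_ge0 2 (normr_ge0 (A i l)))) /eqP.
by rewrite expf_eq0 normr_eq0 => /eqP.
Qed.

Lemma mxdotDl m n (A A' B : 'M[C]_(m, n)) : mxdot (A + A') B = mxdot A B + mxdot A' B.
Proof. by rewrite /mxdot mulmxDl mxtraceD. Qed.
Lemma mxdotDr m n (A A' B : 'M[C]_(m, n)) : mxdot B (A + A') = mxdot B A + mxdot B A'.
Proof. by rewrite /mxdot adjD mulmxDr mxtraceD. Qed.
Lemma mxdotNl m n (A B : 'M[C]_(m, n)) : mxdot (- A) B = - mxdot A B.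
Proof. by rewrite /mxdot mulNmx raddfN. Qed.
Lemma mxdotNr m n (A B : 'M[C]_(m, n)) : mxdot B (- A) = - mxdot B A.
Proof. by rewrite /mxdot linearN map_mxN mulmxN raddfN. Qed.
Lemma mxdotC m n (A B : 'M[C]_(m, n)) : mxdot A B = (mxdot B A)^*.
Proof.
rewrite !mxdotE rmorph_sum; apply: eq_bigr => i _.
rewrite rmorph_sum; apply: eq_bigr => j _.
by rewrite rmorphM /= conjCK mulrC.
Qed.

Lemma nsqN m n (A : 'M[C]_(m, n)) : nsq (- A) = nsq A.
Proof. by rewrite /nsq mxdotNl mxdotNr opprK. Qed.

Lemma nsqD m n (A B : 'M[C]_(m, n)) :
  nsq (A + B) = nsq A + nsq B + (mxdot A B + mxdot B A).
Proof. by rewrite /nsq !(mxdotDl, mxdotDr); ring. Qed.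

Lemma nsqB m n (A B : 'M[C]_(m, n)) :
  nsq (A - B) = nsq A + nsq B - (mxdot A B + mxdot B A).
Proof. by rewrite nsqD nsqN mxdotNl mxdotNr; ring. Qed.

Lemma nsqD_le m n (A B : 'M[C]_(m, n)) : nsq (A + B) <= 2%:R * (nsq A + nsq B).
Proof.
rewrite -subr_ge0 (_ : _ - _ = nsq (A - B)) ?nsq_ge0 //.
by rewrite nsqB nsqD; ring.
Qed.

Lemma nsqB_le m n (A B : 'M[C]_(m, n)) : nsq (A - B) <= 2%:R * (nsq A + nsq B).
Proof. by rewrite -[nsq B]nsqN nsqD_le. Qed.

Lemma nsq_mulr_iso m n p (A : 'M[C]_(m, n)) (U : 'M[C]_(n, p)) :
  U *m U^t* = 1%:M -> nsq (A *m U) = nsq A.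
Proof. by move=> UU; rewrite /nsq /mxdot adjM -mulmxA (mulmxA U) UU mul1mx. Qed.

Lemma nsq_mull_iso m n p (A : 'M[C]_(m, n)) (U : 'M[C]_(p, m)) :
  U^t* *m U = 1%:M -> nsq (U *m A) = nsq A.
Proof.
move=> UU; rewrite /nsq /mxdot adjM mulmxA mxtrace_mulC !mulmxA UU mul1mx //.
Qed.

Lemma nsq_adj m n (A : 'M[C]_(m, n)) : nsq (A^t*) = nsq A.
Proof. by rewrite /nsq /mxdot trmxCK mxtrace_mulC. Qed.

(** Lagrange's identity for the moduli, followed by the triangle inequality. *)
Lemma cauchy_schwarz n (u v : 'I_n -> C) :
  `|\sum_j u j * v j| ^+ 2 <= (\sum_j `|u j| ^+ 2) * (\sum_j `|v j| ^+ 2).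
Proof.
pose a j := `|u j|; pose b j := `|v j|.
have ge0 : 0 <= \sum_i \sum_j (a i * b j - a j * b i) ^+ 2.
  do 2!apply: sumr_ge0 => ? _; rewrite -real_normK ?exprn_ge0 //.
  by rewrite rpredB // rpredM // ger0_real // normr_ge0.
have E : \sum_i \sum_j (a i * b j - a j * b i) ^+ 2 =
    2%:R * ((\sum_j a j ^+ 2) * (\sum_j b j ^+ 2) - (\sum_j a j * b j) ^+ 2).
  transitivity (\sum_i \sum_j (a i ^+ 2 * b j ^+ 2 + b i ^+ 2 * a j ^+ 2
                                 - 2%:R * ((a i * b i) * (a j * b j)))).
    by apply: eq_bigr => i _; apply: eq_bigr => j _; ring.
  under eq_bigr => i _ do rewrite sumrB big_split /= -!mulr_sumr.
  rewrite sumrB big_split /= -!mulr_suml -mulr_sumr -mulr_suml.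
  by rewrite expr2; ring.
move: ge0; rewrite E pmulr_rge0 // subr_ge0; apply: le_trans.
rewrite ler_sqr ?nnegrE ?normr_ge0 ?sumr_ge0 //; last first.
  by move=> j _; rewrite mulr_ge0 ?normr_ge0.
apply: le_trans (ler_norm_sum _ _ _) _.
by under eq_bigr => j _ do rewrite normrM.
Qed.

Lemma nsqM_le m n p (A : 'M[C]_(m, n)) (B : 'M[C]_(n, p)) :
  nsq (A *m B) <= nsq A * nsq B.
Proof.
rewrite [nsq (_ *m _)]nsqE [nsq A]nsqE mulr_suml; apply: ler_sum => i _.
rewrite -[nsq B]nsq_adj nsqE mulr_sumr; apply: ler_sum => j _.
rewrite mxE; apply: le_trans (cauchy_schwarz _ _) _.
apply: ler_wpM2l; first by apply: sumr_ge0 => ? _; rewrite exprn_ge0.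
by apply: ler_sum => k _; rewrite !mxE norm_conjC.
Qed.

Lemma mxdotZl m n (k : C) (A B : 'M[C]_(m, n)) : mxdot (k *: A) B = k * mxdot A B.
Proof. by rewrite /mxdot -scalemxAl mxtraceZ. Qed.

(** A triangle inequality without square roots: nonnegativity of [nsq (b *: A - a *: B)] bounds the
    cross terms. *)
Lemma nsqD_minkowski m n (A B : 'M[C]_(m, n)) (a b s : C) : 0 < a -> 0 < b ->
  nsq A <= a ^+ 2 * s -> nsq B <= b ^+ 2 * s -> nsq (A + B) <= (a + b) ^+ 2 * s.
Proof.
move=> a_gt0 b_gt0 hA hB.
have real_dotZ (k : C) (D E : 'M[C]_(m, n)) : 0 < k -> mxdot D (k *: E) = k * mxdot D E.
  by move=> k_gt0; rewrite mxdotC mxdotZl rmorphM /= geC0_conj ?ltW // -mxdotC.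
have h : a * b * (mxdot A B + mxdot B A) <= a * b * (2%:R * (a * b * s)).
  have h1 : a * b * (mxdot A B + mxdot B A) <= b ^+ 2 * nsq A + a ^+ 2 * nsq B.
    rewrite -subr_ge0 (_ : _ - _ = nsq (b *: A - a *: B)) ?nsq_ge0 //.
    by rewrite nsqB /nsq !mxdotZl !real_dotZ //; ring.
  apply: le_trans h1 _.
  have a2 : 0 <= a ^+ 2 by rewrite exprn_ge0 ?ltW.
  have b2 : 0 <= b ^+ 2 by rewrite exprn_ge0 ?ltW.
  apply: le_trans (lerD (ler_wpM2l b2 hA) (ler_wpM2l a2 hB)) _.
  by rewrite le_eqVlt; apply/orP; left; apply/eqP; ring.
rewrite ler_pM2l ?mulr_gt0 // in h.
rewrite nsqD; apply: le_trans (lerD (lerD hA hB) h) _.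
by rewrite le_eqVlt; apply/orP; left; apply/eqP; ring.
Qed.

End Frobenius.

(** * Spectral compression of a representation *)

Section Compression.
Variables (C : numClosedFieldType) (gT : finGroupType) (n : nat).
Variable rho : gT -> 'M[C]_n.
Hypothesis rhoM : forall x y, rho (x * y)%g = rho x *m rho y.
Hypothesis rho_unitary : forall x, rho x *m (rho x)^t* = 1%:M.

Variable a : 'rV[C]_n.

Definition gram := \sum_x (a *m rho x)^t* *m (a *m rho x).

Lemma gram_adj : gram^t* = gram.
Proof.
rewrite /gram raddf_sum /= map_mx_sum; apply: eq_bigr => x _.
by rewrite adjM trmxCK.
Qed.

(** Conjugation by [rho y] only reindexes the defining sum, sending x to xy. *)
Lemma gram_comm y : gram *m rho y = rho y *m gram.
Proof.
suff E : (rho y)^t* *m gram *m rho y = gram.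
  by rewrite -{2}E !mulmxA rho_unitary mul1mx.
rewrite /gram mulmx_sumr mulmx_suml.
rewrite [RHS](reindex_inj (mulIg y)) /=; apply: eq_bigr => x _.
by rewrite rhoM [a *m (_ *m _)]mulmxA [(_ *m rho y)^t*]adjM !mulmxA.
Qed.

Lemma mul_gram (v w : 'rV[C]_n) :
  (v *m gram *m w^t*) 0 0 =
  \sum_x mxdot v (a *m rho x) * (mxdot w (a *m rho x))^*.
Proof.
rewrite /gram mulmx_sumr mulmx_suml summxE; apply: eq_bigr => x _.
rewrite -mxdotC /mxdot !trace_mx11.
by rewrite mulmxA -[_ *m _ *m w^t*]mulmxA [LHS]mxE big_ord1.
Qed.

Lemma trace_gram : \tr gram = #|gT|%:R * nsq a.
Proof.
rewrite /gram raddf_sum /= mulr_natl -sumr_const; apply: eq_bigr => x _.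
by rewrite mxtrace_mulC -/(mxdot _ _) -/(nsq _) nsq_mulr_iso.
Qed.

(** The rows of [W] are orthonormal eigenvectors of [gram] for the eigenvalues at least [theta]. The
    trace bounds their number, and the projection onto their span is spectral, so it commutes with
    whatever commutes with [gram]. *)
Lemma spectral_compression (theta : C) : 0 < theta ->
  exists (m : nat) (W : 'M[C]_(m, n)),
  [/\ W *m W^t* = 1%:M, m%:R * theta <= #|gT|%:R * nsq a,
     forall x, W^t* *m W *m rho x = rho x *m (W^t* *m W) &
     let g := a - a *m W^t* *m W in
     \sum_x `|mxdot g (a *m rho x)| ^+ 2 <= theta * nsq g].
Proof.
move=> theta_gt0.
have /orthomx_spectralP E : gram \is normalmx.
  by apply/normalmxP; rewrite gram_adj.
set P := spectralmx gram in E; set D := spectral_diag gram in E.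
have Pu : P \is unitarymx by apply: spectral_unitarymx.
have PP : P *m P^t* = 1%:M by apply/unitarymxP.
have PP' : P^t* *m P = 1%:M by apply: mulmx1C.
rewrite invmx_unitary // in E.
have PE : P *m gram = diag_mx D *m P by rewrite E !mulmxA PP mul1mx.
have EP : gram *m P^t* = P^t* *m diag_mx D by rewrite E -!mulmxA PP mulmx1.
have D_ge0 i : 0 <= D 0 i.
  have -> : D 0 i = (row i P *m gram *m (row i P)^t*) 0 0.
    rewrite -row_mul PE row_mul row_diag_mx -scalemxAl -scalemxAl mxE.
    rewrite -rowE -[LHS]mulr1; congr (_ * _).
    have /matrixP/(_ i i) := PP; rewrite mxE [RHS]mxE eqxx => E1.
    by rewrite mxE -[LHS]E1; apply: eq_bigr => j _; rewrite !mxE.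
  by rewrite mul_gram; apply: sumr_ge0 => x _; rewrite -normCK exprn_ge0.
pose I := [set i | theta <= D 0 i].
pose f (k : 'I_#|I|) : 'I_n := enum_val k.
pose W := rowsub f P.
pose e : 'rV[C]_n := \row_i (i \in I)%:R.
have WQ : W^t* *m W = P^t* *m diag_mx e *m P.
  apply/matrixP => i j; rewrite -mulmxA mul_diag_mx !mxE.
  rewrite (eq_bigr (fun k : 'I_n => if k \in I then (P k i)^* * P k j else 0)); last first.
    by move=> k _; rewrite !mxE; case: (k \in I); rewrite ?mul1r ?mul0r ?mulr0.
  rewrite -big_mkcond /= [RHS]big_enum_val /=.
  by apply: eq_bigr => k _; rewrite !mxE.
have WW : W *m W^t* = 1%:M.
  apply/matrixP => i j; rewrite !mxE.
  have /matrixP/(_ (f i) (f j)) := PP; rewrite !mxE (inj_eq enum_val_inj) => <-.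
  by apply: eq_bigr => k _; rewrite !mxE.
(* In the eigenbasis [r] commutes with [diag_mx D], so its (i, j) entry vanishes unless the
   eigenvalues at i and j agree, and then i and j are both in [I] or both outside. *)
have comm x : W^t* *m W *m rho x = rho x *m (W^t* *m W).
  have [r r_def] : exists r, r = P *m rho x *m P^t* by eexists.
  have Dr : diag_mx D *m r = r *m diag_mx D.
    by rewrite r_def !mulmxA -PE -[P *m gram *m _]mulmxA gram_comm -!mulmxA EP.
  have er : diag_mx e *m r = r *m diag_mx e.
    apply/matrixP => i j; rewrite mul_diag_mx mul_mx_diag !mxE.
    have /matrixP/(_ i j) := Dr; rewrite mul_diag_mx mul_mx_diag mxE [RHS]mxE mulrC.
    have [-> _|r0 /(mulfI r0) Dij] := eqVneq (r i j) 0; first by rewrite mulr0 mul0r.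
    by rewrite !inE Dij mulrC.
  have rE : rho x = P^t* *m r *m P by rewrite r_def !mulmxA PP' mul1mx -mulmxA PP' mulmx1.
  rewrite WQ rE; transitivity (P^t* *m (diag_mx e *m r) *m P).
    by rewrite !mulmxA -[_ *m P *m P^t*]mulmxA PP mulmx1.
  by rewrite er !mulmxA -[_ *m P *m P^t*]mulmxA PP mulmx1.
exists #|I|, W; split=> //.
  rewrite -trace_gram E -mulmxA mxtrace_mulC -mulmxA PP mulmx1 mxtrace_diag.
  rewrite (bigID (mem I)) /= mulr_natl -sumr_const.
  rewrite -[leLHS]addr0; apply: lerD; last by apply: sumr_ge0.
  by apply: ler_sum => i; rewrite inE.
move=> g; pose b := a *m P^t*.
(* In eigencoordinates [g] keeps exactly the coordinates of [a] outside [I], where the eigenvalues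
   lie below [theta]. *)
have gE : g = (\row_i (b 0 i * (i \notin I)%:R)) *m P.
  rewrite /g -!mulmxA WQ -{1}[a]mulmx1 -PP' !mulmxA -mulmxBl; congr (_ *m _).
  apply/rowP => i; rewrite -/b mul_mx_diag !mxE.
  by case: (i \in I); rewrite /= ?mulr0 ?mulr1 ?subrr ?subr0.
set w := \row_i _ in gE.
have := mul_gram g g; under eq_bigr => x _ do rewrite -normCK.
move=> <-; rewrite gE nsq_mulr_iso // adjM.
rewrite -[w *m P *m gram]mulmxA PE -!mulmxA (mulmxA P) PP mul1mx.
rewrite nsqE big_ord1 mulr_sumr mulmxA mul_mx_diag mxE; apply: ler_sum => i _.
rewrite !mxE; case: (boolP (i \in I)) => [iI|]; rewrite ?mulr0 ?mul0r ?normr0 ?expr0n ?mulr0 //.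
rewrite inE => iI /=; rewrite !mulr1 mulrAC -normCK [leLHS]mulrC ler_wpM2r ?exprn_ge0 //.
by rewrite real_leNgt ?ger0_real // ?(ltW theta_gt0) //; apply: contra iI => /ltW.
Qed.

End Compression.

Section Projection.
Variables (C : numClosedFieldType) (n : nat) (Q : 'M[C]_n).
Hypotheses (QQ : Q *m Q = Q) (Qadj : Q^t* = Q).

Lemma mxdot_proj0 m (u v : 'M[C]_(m, n)) : mxdot (u - u *m Q) (v *m Q) = 0.
Proof. by rewrite /mxdot adjM Qadj mulmxA mulmxBl -mulmxA QQ subrr mul0mx mxtrace0. Qed.

Lemma nsq_proj m (u : 'M[C]_(m, n)) : nsq u = nsq (u - u *m Q) + nsq (u *m Q).
Proof.
by rewrite -{1}(subrK (u *m Q) u) [LHS]nsqD mxdot_proj0 [mxdot (u *m Q) _]mxdotC mxdot_proj0 rmorph0 !addr0.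
Qed.

Lemma nsq_proj_le m (u : 'M[C]_(m, n)) : nsq (u *m Q) <= nsq u.
Proof. by rewrite [leRHS]nsq_proj lerDr nsq_ge0. Qed.

Lemma nsq_coproj_le m (u : 'M[C]_(m, n)) : nsq (u - u *m Q) <= nsq u.
Proof. by rewrite [leRHS]nsq_proj lerDl nsq_ge0. Qed.

End Projection.

Section Approximation.
Variables (C : numClosedFieldType) (gT : finGroupType) (n : nat).
Variable rho : gT -> 'M[C]_n.
Hypothesis rhoM : forall x y, rho (x * y)%g = rho x *m rho y.
Hypothesis rho_unitary : forall x, rho x *m (rho x)^t* = 1%:M.

(* With [g] the component of [a] orthogonal to the compression, [g rho(x)] has
   inner product at least [nsq g / 2] with [g] for all [x] in [S] as soon as
   [eta < nsq g], which contradicts the eigenvalue bound [theta]. *)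
Lemma rep_approx (a : 'rV[C]_n) (theta eta : C) (S : {set gT}) :
  0 < theta -> S != set0 -> 0 <= eta ->
  (forall x, x \in S -> nsq (a *m rho x - a) <= eta) ->
  4%:R * theta <= #|S|%:R * eta ->
  exists (m : nat) (tau : gT -> 'M[C]_m),
  [/\ forall x y, tau (x * y)%g = tau x *m tau y,
     forall x, (tau x)^t* *m tau x = 1%:M,
     m%:R * theta <= #|gT|%:R * nsq a &
     forall (x : gT) (c : C), 0 <= c ->
       (forall v : 'cV[C]_m, nsq ((tau x - 1%:M) *m v) <= c * nsq v) ->
       nsq (a *m rho x - a) <= 8%:R * eta + 2%:R * (c * nsq a)].
Proof.
move=> theta_gt0 S0 eta_ge0 hS htheta.
have [m [W [WW mW comm Sum]]] := spectral_compression rhoM rho_unitary a theta_gt0.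
pose Q := W^t* *m W; pose g := a - a *m Q.
have commQ x : Q *m rho x = rho x *m Q := comm x.
have SumQ : \sum_x `|mxdot g (a *m rho x)| ^+ 2 <= theta * nsq g.
  by have := Sum; rewrite /= -mulmxA.
have QQ : Q *m Q = Q by rewrite /Q mulmxA -[_ *m W *m W^t*]mulmxA WW mulmx1.
have Qadj : Q^t* = Q by rewrite /Q adjM trmxCK.
have WQ : W *m Q = W by rewrite /Q mulmxA WW mul1mx.
have [tau tauE] : exists tau : gT -> 'M_m, forall x, tau x = W *m rho x *m W^t* by eexists.
have Wrho x : W *m rho x = tau x *m W.
  by rewrite tauE -[RHS]mulmxA -/Q -[RHS]mulmxA -commQ mulmxA WQ.
have tauM x y : tau (x * y)%g = tau x *m tau y.
  transitivity (W *m (rho x *m rho y) *m W^t*); first by rewrite tauE rhoM.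
  by rewrite (mulmxA W) Wrho -(mulmxA (tau x)) Wrho -!mulmxA WW mulmx1.
have tauU x : tau x *m (tau x)^t* = 1%:M.
  have -> : (tau x)^t* = W *m ((rho x)^t* *m W^t*) by rewrite tauE !adjM trmxCK.
  rewrite mulmxA -Wrho -!mulmxA.
  by rewrite (mulmxA (rho x)) rho_unitary mul1mx WW.
have nsq_g : nsq g <= eta.
  have g_real : nsq g \is Num.real by rewrite ger0_real ?nsq_ge0.
  rewrite real_leNgt ?ger0_real ?nsq_ge0 //; apply/negP => lt_g.
  have g_gt0 : 0 < nsq g by apply: le_lt_trans lt_g.
  have hx x : x \in S -> (nsq g / 2%:R) ^+ 2 <= `|mxdot g (a *m rho x)| ^+ 2.
    move=> xS.
    have -> : mxdot g (a *m rho x) = mxdot g (g *m rho x).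
      rewrite {2}/g mulmxBl mxdotDr mxdotNr -[a *m Q *m _]mulmxA commQ mulmxA.
      by rewrite [mxdot g (_ *m Q)]mxdot_proj0 // subr0.
    have : nsq (g *m rho x - g) <= eta.
      apply: le_trans (hS x xS); rewrite /g.
      have -> : (a - a *m Q) *m rho x - (a - a *m Q) =
          (a *m rho x - a) - (a *m rho x - a) *m Q.
        rewrite !mulmxBl -[a *m Q *m _]mulmxA commQ mulmxA.
        by rewrite !opprB addrACA [RHS]addrACA; congr (_ + _); rewrite addrC.
      exact: nsq_coproj_le.
    rewrite nsqB nsq_mulr_iso // => /le_lt_trans/(_ lt_g).
    set z := mxdot g _; rewrite [mxdot (_ *m _) _]mxdotC -/z => h.
    rewrite ler_sqr ?nnegrE ?normr_ge0 ?divr_ge0 ?ler0n ?nsq_ge0 //.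
    rewrite ler_pdivrMr // -subr_ge0.
    have h1 : nsq g <= z + z^*.
      move: h; rewrite -subr_gt0 -subr_ge0 => /ltW; congr (0 <= _); ring.
    rewrite subr_ge0; apply: le_trans h1 _.
    have zz : z + z^* \is Num.real by rewrite CrealE rmorphD /= conjCK addrC.
    apply: le_trans (real_ler_norm zz) _; apply: le_trans (ler_normD _ _) _.
    by rewrite norm_conjC mulrDr mulr1.
  (* Summing over [S] gives |S| nsq(g)/4 <= theta after division by nsq(g), and 4 theta <= |S| eta
     then forces nsq(g) <= eta. *)
  have : #|S|%:R * (nsq g / 2%:R) ^+ 2 <= theta * nsq g.
    apply: le_trans SumQ; rewrite mulr_natl -sumr_const.
    rewrite [leRHS](bigID (mem S)) /= -[leLHS]addr0; apply: lerD; last first.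
      by apply: sumr_ge0 => x _; rewrite exprn_ge0.
    by apply: ler_sum.
  have -> : #|S|%:R * (nsq g / 2%:R) ^+ 2 = (#|S|%:R / 4%:R * nsq g) * nsq g by field.
  rewrite ler_pM2r // mulrAC ler_pdivrMr // [theta * _]mulrC => /le_trans/(_ htheta).
  rewrite ler_pM2l ?ltr0n ?card_gt0 // => /le_gtF.
  by rewrite lt_g.
exists m, tau; split=> //.
  by move=> x; apply: mulmx1C.
move=> x c c_ge0 hc.
(* Split [a] into [g], which moves by at most 4 eta because its norm is small, and its projection,
   on which [rho] acts through [tau]. Recombining doubles both bounds. *)
have -> : a *m rho x - a = (g *m rho x - g) + (a *m Q *m rho x - a *m Q).
  by rewrite addrACA -mulmxDl subrK -opprD subrK.
apply: le_trans (nsqD_le _ _) _.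
have h1 : nsq (g *m rho x - g) <= 4%:R * eta.
  apply: le_trans (nsqB_le _ _) _; rewrite nsq_mulr_iso //.
  by rewrite (_ : _ * _ = 4%:R * nsq g) ?ler_pM2l //; ring.
have h2 : nsq (a *m Q *m rho x - a *m Q) <= c * nsq a.
  have -> : a *m Q *m rho x - a *m Q = (a *m W^t* *m (tau x - 1%:M)) *m W.
    by rewrite mulmxBr mulmxBl mulmx1 -[_ *m tau x *m W]mulmxA -Wrho /Q !mulmxA.
  rewrite nsq_mulr_iso //.
  set u := a *m W^t*.
  (* The hypothesis on [tau x - 1%:M] concerns column vectors; pulling out the unitary [tau x] and
     taking adjoints turns the row product into one. *)
  have -> : nsq (u *m (tau x - 1%:M)) = nsq ((tau x - 1%:M) *m u^t*).
    have -> : u *m (tau x - 1%:M) = - ((u *m ((tau x)^t* - 1%:M)) *m tau x).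
      by rewrite -[u *m _ *m tau x]mulmxA mulmxBl (mulmx1C (tauU x)) mul1mx -mulmxN opprB.
    rewrite nsqN nsq_mulr_iso // -nsq_adj adjM adjB adj1 trmxCK //.
  apply: le_trans (hc _) _; rewrite ler_wpM2l // nsq_adj /u.
  by rewrite -(nsq_mulr_iso _ WW) -mulmxA nsq_proj_le.
apply: le_trans (ler_wpM2l _ (lerD h1 h2)) _ => //.
by rewrite mulrDr (_ : 2%:R * (4%:R * eta) = 8%:R * eta) //; ring.
Qed.

End Approximation.

(** * Jordan's theorem *)

Section Unitary.
Variables (C : numClosedFieldType) (m : nat).
Implicit Types (A B P : 'M[C]_m).

Lemma comm_adj A B : B^t* *m B = 1%:M -> A *m B = B *m A ->
  A *m B^t* = B^t* *m A.
Proof.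
move=> BB AB; have BB' : B *m B^t* = 1%:M by apply: mulmx1C.
by rewrite -[A in LHS]mul1mx -BB -(mulmxA _ B) -AB -!mulmxA BB' mulmx1.
Qed.

(** The family is enlarged by its adjoints before simultaneous unitary triangularization: a matrix
    that is triangular on the same side as its adjoint is diagonal. *)
Lemma unitary_codiag (s : seq 'M[C]_m) :
  {in s, forall A : 'M[C]_m, A^t* *m A = 1%:M} ->
  {in s &, forall A B : 'M[C]_m, A *m B = B *m A} ->
  exists2 P : 'M[C]_m, P \is unitarymx & {in s, forall A : 'M[C]_m, is_diag_mx (P *m A *m P^t*)}.
Proof.
move=> sU sC.
have [|P Pu /allP hP] := @cotrigonalization C m (s ++ [seq A^t* | A <- s]).
  move=> A0 B0; rewrite !mem_cat => /orP[As|/mapP[A As ->]] /orP[Bs|/mapP[B Bs ->]].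
  - exact: sC.
  - by apply: comm_adj; [apply: sU|apply: sC].
  - by symmetry; apply: comm_adj; [apply: sU|apply: sC].
  - by rewrite /comm_mx -!adjM sC.
exists P => // A As; apply/is_diag_mxP => i j ij.
have trig B : B \in s ++ [seq A^t* | A <- s] -> is_trig_mx (P *m B *m P^t*).
  by move=> /hP; rewrite -conjymx.
have /is_trig_mxP h1 : is_trig_mx (P *m A *m P^t*) by rewrite trig // mem_cat As.
have /is_trig_mxP h2 : is_trig_mx (P *m A^t* *m P^t*).
  by rewrite trig // mem_cat; apply/orP; right; apply/mapP; exists A.
have [lt_ij|lt_ji|/val_inj E] := ltngtP i j; [exact: h1| |by rewrite E eqxx in ij].
have := h2 j i lt_ji.
have -> : P *m A^t* *m P^t* = (P *m A *m P^t*)^t* by rewrite !adjM trmxCK mulmxA.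
by rewrite 2!mxE => /eqP; rewrite conjC_eq0 => /eqP.
Qed.

Lemma norm_entry_le_nsq n p (A : 'M[C]_(n, p)) i j : `|A i j| ^+ 2 <= nsq A.
Proof.
rewrite nsqE (bigD1 i) //= (bigD1 j) //= -addrA lerDl addr_ge0 //.
  by apply: sumr_ge0 => k _; rewrite exprn_ge0.
by do 2!apply: sumr_ge0 => ? _; rewrite exprn_ge0.
Qed.

(* In a common eigenbasis of [g] and [h g h^*], the diagonal entries of [h] do
   not vanish, so the two matrices have the same eigenvalues there. *)
Lemma comm_conj_near1 (g h : 'M[C]_m) :
  g^t* *m g = 1%:M -> h^t* *m h = 1%:M -> nsq (h - 1%:M) < 1 ->
  g *m (h *m g *m h^t*) = (h *m g *m h^t*) *m g -> g *m h = h *m g.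
Proof.
move=> gU hU h1.
have [g' g'E] : exists g', g' = h *m g *m h^t* by eexists.
rewrite -g'E => gg'.
have hU' := mulmx1C hU.
have g'U : g'^t* *m g' = 1%:M.
  by rewrite g'E !adjM trmxCK -!mulmxA (mulmxA _ h) hU mul1mx (mulmxA _ g) gU mul1mx.
have [|A B|P Pu diag] := @unitary_codiag [:: g; g'].
- by move=> A; rewrite !inE => /orP[]/eqP->.
- by rewrite !inE => /orP[]/eqP-> /orP[]/eqP->.
have PP : P *m P^t* = 1%:M by apply/unitarymxP.
have PP' := mulmx1C PP.
have dg := is_diag_mxP (diag g (mem_head _ _)).
have dg' := is_diag_mxP (diag g' (mem_last g [:: g'])).
have [H HE] : exists H, H = P *m h *m P^t* by eexists.
have HG : H *m (P *m g *m P^t*) = (P *m g' *m P^t*) *m H.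
  have hg : h *m g = g' *m h by rewrite g'E -!mulmxA hU mulmx1.
  rewrite HE !mulmxA -[_ *m P^t* *m P]mulmxA PP' mulmx1 -[_ *m h *m g]mulmxA hg.
  by rewrite -[X in _ = X *m h *m _]mulmxA PP' mulmx1 !mulmxA.
(* A zero diagonal entry of [H] would give an entry -1 of [H - 1%:M], hence squared norm at least
   1. *)
have H0 i : H i i != 0.
  apply: contraTneq h1 => Hi.
  have -> : nsq (h - 1%:M) = nsq (H - 1%:M).
    rewrite (_ : H - 1%:M = P *m (h - 1%:M) *m P^t*); last first.
      by rewrite mulmxBr mulmxBl mulmx1 PP HE.
    by rewrite nsq_mulr_iso ?trmxCK // nsq_mull_iso.
  apply/negP => /le_lt_trans-/(_ _ (norm_entry_le_nsq (H - 1%:M) i i)).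
  by rewrite !mxE eqxx Hi sub0r normrN normr1 expr1n ltxx.
suff E : P *m g *m P^t* = P *m g' *m P^t*.
  have gE : g = g'.
    have := congr1 (fun X => P^t* *m X *m P) E.
    by rewrite !mulmxA PP' !mul1mx -!mulmxA PP' !mulmx1.
  by rewrite {1}gE g'E -mulmxA hU mulmx1.
apply/matrixP => i j; have [<-|ij] := eqVneq i j; last by rewrite dg // dg'.
have /matrixP/(_ i i) := HG; rewrite [LHS]mxE [RHS]mxE.
rewrite (bigD1 i) //= big1 => [|k ki]; last by rewrite dg ?mulr0.
rewrite [RHS](bigD1 i) //= [X in _ = _ + X]big1 => [|k ki]; last by rewrite dg' ?mul0r // eq_sym.
by rewrite !addr0 mulrC => /(mulIf (H0 i)).
Qed.

End Unitary.

Section Jordan.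
Variables (C : numClosedFieldType) (m : nat) (gT : finGroupType).
Variable tau : gT -> 'M[C]_m.
Hypothesis tauM : forall x y, tau (x * y)%g = tau x *m tau y.
Hypothesis tauU : forall x, (tau x)^t* *m tau x = 1%:M.

(** This radius absorbs the factor 4 of [nsq_commutator]: commuting y with an element of [near1]
    yields something strictly closer to the identity than y, unless [tau y] is the identity. *)
Definition near1 := [set x | nsq (tau x - 1%:M) < 4%:R^-1].

Lemma tau1 : tau 1%g = 1%:M.
Proof.
have := tauM 1 1; rewrite mulg1 => /(congr1 (mulmx ((tau 1%g)^t*))).
by rewrite mulmxA tauU mul1mx.
Qed.

Lemma tauV x : tau x^-1%g = (tau x)^t*.
Proof.
have := tauM x^-1 x; rewrite mulVg tau1 => /(congr1 (mulmx^~ ((tau x)^t*))).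
by rewrite mul1mx -mulmxA (mulmx1C (tauU x)) mulmx1.
Qed.

Lemma tauU' x : tau x *m (tau x)^t* = 1%:M.
Proof. exact: mulmx1C. Qed.

Lemma nsq_tauJ x y : nsq (tau (x ^ y)%g - 1%:M) = nsq (tau x - 1%:M).
Proof.
have -> : tau (x ^ y)%g - 1%:M = (tau y)^t* *m (tau x - 1%:M) *m tau y.
  by rewrite /conjg !tauM tauV mulmxBr mulmxBl mulmx1 tauU mulmxA.
by rewrite nsq_mulr_iso ?tauU' // nsq_mull_iso // trmxCK tauU'.
Qed.

(** Here gh - hg = (g-1)(h-1) - (h-1)(g-1), and dividing by the unitary hg on the right keeps the
    norm. *)
Lemma nsq_commutator x y :
  nsq (tau (x * y * x^-1 * y^-1)%g - 1%:M) <=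
  4%:R * (nsq (tau x - 1%:M) * nsq (tau y - 1%:M)).
Proof.
set g := tau x; set h := tau y.
have -> : tau (x * y * x^-1 * y^-1)%g - 1%:M =
    ((g - 1%:M) *m (h - 1%:M) - (h - 1%:M) *m (g - 1%:M)) *m (g^t* *m h^t*).
  have -> : (g - 1%:M) *m (h - 1%:M) - (h - 1%:M) *m (g - 1%:M) = g *m h - h *m g.
    rewrite !(mulmxBr, mulmxBl) !mul1mx !mulmx1.
    rewrite !opprB !addrA; apply/matrixP => i j; rewrite !mxE; ring.
  rewrite !tauM !tauV -/g -/h mulmxBl !mulmxA; congr (_ - _).
  by rewrite -[h *m g *m _]mulmxA tauU' mulmx1 tauU'.
rewrite nsq_mulr_iso; last first.
  by rewrite adjM !trmxCK -mulmxA (mulmxA _ h) tauU mul1mx tauU.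
apply: le_trans (nsqB_le _ _) _.
have -> : 4%:R * (nsq (g - 1%:M) * nsq (h - 1%:M)) = 2%:R *
  (nsq (g - 1%:M) * nsq (h - 1%:M) + nsq (h - 1%:M) * nsq (g - 1%:M)) by ring.
by rewrite ler_pM2l //; apply: lerD; apply: nsqM_le.
Qed.

(* Minimal counterexample: the commutator [x y x^-1 y^-1] is strictly closer to
   the identity than [y]. *)
Lemma near1_comm x y : x \in near1 -> y \in near1 -> tau x *m tau y = tau y *m tau x.
Proof.
rewrite inE => xS.
(* The values of the norm are not well ordered, so the induction is on the number of group elements
   strictly closer to the identity. *)
pose lower y := [set z | nsq (tau z - 1%:M) < nsq (tau y - 1%:M)].
elim: {y}_.+1 {-2}y (ltnSn #|lower y|) => // k IH y; rewrite ltnS => ky.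
rewrite inE => yS.
have [/eqP|y0] := eqVneq (nsq (tau y - 1%:M)) 0.
  by rewrite nsq_eq0 subr_eq0 => /eqP->; rewrite mulmx1 mul1mx.
pose z := (x * y * x^-1 * y^-1)%g.
have zy : nsq (tau z - 1%:M) < nsq (tau y - 1%:M).
  apply: le_lt_trans (nsq_commutator x y) _.
  have y_gt0 : 0 < nsq (tau y - 1%:M) by rewrite lt_def y0 nsq_ge0.
  by rewrite mulrA gtr_pMl // -ltr_pdivlMl // mulr1.
have zS : z \in near1 by rewrite inE (lt_trans zy).
have lz : (#|lower z| < k)%N.
  apply: leq_trans ky; apply: proper_card; apply/properP; split.
    by apply/subsetP => w; rewrite !inE => /lt_trans; apply.
  by exists z; rewrite !inE ?ltxx.
have xz := IH z lz zS.
(* Under [tau], x commutes with the commutator [z], hence with y x^-1 y^-1, hence with its adjoint y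
   x y^-1, which is the conjugate required here. *)
apply: comm_conj_near1 => //.
  by apply: lt_trans yS _; rewrite invf_lt1 // ltr1n.
have zE : tau z = tau x *m (tau y *m (tau x)^t* *m (tau y)^t*).
  by rewrite /z !tauM !tauV !mulmxA.
have h : tau x *m (tau y *m (tau x)^t* *m (tau y)^t*) =
    (tau y *m (tau x)^t* *m (tau y)^t*) *m tau x.
  have := congr1 (mulmx ((tau x)^t*)) xz.
  by rewrite zE !mulmxA tauU !mul1mx.
have -> : tau y *m tau x *m (tau y)^t* = (tau y *m (tau x)^t* *m (tau y)^t*)^t*.
  by rewrite !adjM !trmxCK mulmxA.
apply: comm_adj => //.
by rewrite !adjM !trmxCK -!mulmxA (mulmxA _ (tau y)) tauU mul1mx (mulmxA _ ((tau x)^t*)) tauU' mul1mx tauU'.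
Qed.

Lemma near1_gen_normal : (<<near1>> <| [set: gT])%g.
Proof.
rewrite /normal subsetT; apply: subset_trans (norm_gen _).
by apply/subsetP => y _; rewrite inE; apply/subsetP => _ /imsetP[x xS ->]; rewrite !inE nsq_tauJ in xS *.
Qed.

(** The commuting images of [near1] are diagonal in a common basis, and the elements with diagonal
    image in that basis form a subgroup. *)
Lemma jordan : exists2 P : 'M[C]_m, P \is unitarymx &
  forall x, x \in <<near1>>%g -> is_diag_mx (P *m tau x *m P^t*).
Proof.
have [||P Pu diag] := @unitary_codiag C m [seq tau x | x <- enum near1].
- by move=> _ /mapP[x _ ->].
- move=> _ _ /mapP[x] + -> /mapP[y] + ->; rewrite !mem_enum.
  exact: near1_comm.
exists P => //.
have PP : P *m P^t* = 1%:M by apply/unitarymxP.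
have gD : group_set [set x | is_diag_mx (P *m tau x *m P^t*)].
  apply/group_setP; split => [|x y].
    by rewrite inE tau1 mulmx1 PP scalar_mx_is_diag.
  rewrite !inE => /is_diag_mxP dx /is_diag_mxP dy; rewrite tauM.
  have -> : P *m (tau x *m tau y) *m P^t* = (P *m tau x *m P^t*) *m (P *m tau y *m P^t*).
    by rewrite !mulmxA -[_ *m P^t* *m P]mulmxA (mulmx1C PP) mulmx1.
  apply/is_diag_mxP => i j ij; rewrite mxE big1 // => k _.
  have [<-|ik] := eqVneq i k; first by rewrite dy ?mulr0.
  by rewrite dx ?mul0r.
move=> x xS; suff : x \in Group gD by rewrite inE.
move: x xS; apply/subsetP; rewrite gen_subG; apply/subsetP => x xS.
by rewrite inE; apply: diag; apply: map_f; rewrite mem_enum.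
Qed.

End Jordan.

(** * Bohr neighborhoods *)

Local Open Scope complex_scope.

Section ComplexMatrices.
Variable R : realType.
Local Notation Cx := (R[i])%type.

(** The real-valued form of [nsq], for which square roots and real arithmetic are available. *)
Definition nsqR m n (A : 'M[Cx]_(m, n)) : R :=
  \sum_i \sum_j (complex.Re (A i j) ^+ 2 + complex.Im (A i j) ^+ 2).

Lemma nsqRE m n (A : 'M[Cx]_(m, n)) : (nsqR A)%:C = nsq A.
Proof.
rewrite nsqE rmorph_sum; apply: eq_bigr => i _.
by rewrite rmorph_sum; apply: eq_bigr => j _; rewrite /= add_Re2_Im2.
Qed.

Lemma nsqR_ge0 m n (A : 'M[Cx]_(m, n)) : 0 <= nsqR A.
Proof. by rewrite -ler0c nsqRE nsq_ge0. Qed.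

Lemma vnorm2E m (v : 'cV[Cx]_m) : (vnorm2 v)%:C = nsq v.
Proof.
rewrite -nsqRE; congr (_%:C); apply: eq_bigr => i _.
by rewrite big_ord1.
Qed.

Lemma adjmxE m (A : 'M[Cx]_m) : adjmx A = A^t*.
Proof. by rewrite /adjmx -map_trmx. Qed.

Lemma opnorm_ltE m (A : 'M[Cx]_m) (delta : R) :
  opnorm_lt A delta <-> exists c : R, [/\ 0 <= c, c < delta &
    forall v : 'cV[Cx]_m, nsq (A *m v) <= (c ^+ 2)%:C * nsq v].
Proof.
split=> -[c [c0 cd h]]; exists c; split=> // v.
  by rewrite -!vnorm2E -rmorphM lecR.
by have := h v; rewrite -!vnorm2E -rmorphM lecR.
Qed.

(** The Frobenius norm dominates the operator norm and so is itself an admissible constant. *)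
Lemma opnorm_lt_nsq m (A : 'M[Cx]_m) (delta : R) : 0 < delta ->
  nsq A < (delta ^+ 2)%:C -> opnorm_lt A delta.
Proof.
move=> d_gt0; rewrite -nsqRE ltcR => hA; apply/opnorm_ltE.
exists (Num.sqrt (nsqR A)); split; first exact: sqrtr_ge0.
  by rewrite -[ltRHS]ger0_norm ?ltW // -sqrtr_sqr ltr_sqrt // exprn_gt0.
by move=> v; rewrite sqr_sqrtr ?nsqR_ge0 // nsqRE nsqM_le.
Qed.

Lemma opnorm_lt_le m (A : 'M[Cx]_m) (d d' : R) : d <= d' -> opnorm_lt A d -> opnorm_lt A d'.
Proof. by move=> dd' [c [c0 cd h]]; exists c; split=> //; apply: lt_le_trans dd'. Qed.

Lemma opnorm_lt0 m (delta : R) : 0 < delta -> opnorm_lt (0 : 'M[Cx]_m) delta.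
Proof.
move=> d0; apply: (opnorm_ltE _ _).2; exists 0; split=> // v.
by rewrite mul0mx expr0n /= mul0r; have /eqP -> : nsq (0 : 'cV[Cx]_m) == 0 by rewrite nsq_eq0.
Qed.

Section Rep.
Variables (gT : finGroupType) (m : nat) (tau : gT -> 'M[Cx]_m).
Hypothesis tauM : forall x y, tau (x * y)%g = tau x *m tau y.
Hypothesis tauU : forall x, (tau x)^t* *m tau x = 1%:M.

Lemma opnorm_lt_tauV x d : opnorm_lt (tau x - 1%:M) d -> opnorm_lt (tau x^-1%g - 1%:M) d.
Proof.
move=> hx; have [c [c0 cd h]] := (opnorm_ltE _ _).1 hx.
apply: (opnorm_ltE _ _).2; exists c; split; [exact: c0|exact: cd|move=> v].
have -> : tau x^-1%g - 1%:M = - (tau x - 1%:M) *m tau x^-1%g.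
  by rewrite mulNmx mulmxBl -tauM mulgV tau1 // mul1mx opprB.
rewrite mulNmx mulNmx nsqN -mulmxA; apply: le_trans (h _) _.
by rewrite nsq_mull_iso // tauV // trmxCK tauU'.
Qed.

Lemma opnorm_lt_tauM x y d e :
  opnorm_lt (tau x - 1%:M) d -> opnorm_lt (tau y - 1%:M) e ->
  opnorm_lt (tau (x * y)%g - 1%:M) (d + e).
Proof.
move=> hx hy.
have [c [c0 cd {}hx]] := (opnorm_ltE _ _).1 hx.
have [b [b0 be {}hy]] := (opnorm_ltE _ _).1 hy.
(* Since [c] and [b] may be zero, they are moved to midpoints, which are positive as
   [nsqD_minkowski] requires. *)
pose c' := (c + d) / 2%:R; pose b' := (b + e) / 2%:R.
have c'd : c' < d by rewrite /c'; lra.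
have b'e : b' < e by rewrite /b'; lra.
have c'0 : 0 < c' by rewrite /c'; lra.
have b'0 : 0 < b' by rewrite /b'; lra.
have cc' : c ^+ 2 <= c' ^+ 2 by rewrite ler_sqr ?nnegrE // ?ltW // /c'; lra.
have bb' : b ^+ 2 <= b' ^+ 2 by rewrite ler_sqr ?nnegrE // ?ltW // /b'; lra.
apply: (opnorm_ltE _ _).2; exists (c' + b'); split; [by rewrite addr_ge0 ?ltW|exact: ltrD|move=> v].
have -> : (tau (x * y)%g - 1%:M) *m v = (tau x - 1%:M) *m (tau y *m v) + (tau y - 1%:M) *m v.
  by rewrite tauM !mulmxBl mulmxA !mul1mx addrA subrK.
have -> : ((c' + b') ^+ 2)%:C = (c'%:C + b'%:C) ^+ 2 :> Cx by rewrite -rmorphD -rmorphXn.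
have c'C : 0 < c'%:C :> Cx by rewrite ltcR.
have b'C : 0 < b'%:C :> Cx by rewrite ltcR.
have sqC (t : R) : t%:C ^+ 2 = (t ^+ 2)%:C :> Cx by rewrite -rmorphXn.
apply: nsqD_minkowski; [exact: c'C|exact: b'C| |]; rewrite sqC.
  apply: le_trans (hx _) _; rewrite nsq_mull_iso //.
  by rewrite ler_wpM2r ?nsq_ge0 // lecR.
by apply: le_trans (hy _) _; rewrite ler_wpM2r ?nsq_ge0 // lecR.
Qed.

End Rep.

Lemma unitary_entry_le1 m (U : 'M[Cx]_m) i j : U *m U^t* = 1%:M ->
  -1 <= complex.Re (U i j) <= 1 /\ -1 <= complex.Im (U i j) <= 1.
Proof.
move=> UU.
have : nsqR (row i U) = 1.
  apply: complexI; rewrite nsqRE /nsq /mxdot trace_mx11 [RHS](_ : _ = (1 : Cx)) //.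
  have /matrixP/(_ i i) := UU; rewrite [RHS]mxE eqxx mulr1n => <-.
  by rewrite !mxE; apply: eq_bigr => k _; rewrite !mxE.
rewrite /nsqR big_ord1 (bigD1 j) //= mxE => h.
have : complex.Re (U i j) ^+ 2 + complex.Im (U i j) ^+ 2 <= 1.
  rewrite -h lerDl; apply: sumr_ge0 => k _.
  by rewrite addr_ge0 ?sqr_ge0.
move: (complex.Re _) (complex.Im _) => a b hab.
have sq_le1 (t : R) : t ^+ 2 <= 1 -> -1 <= t <= 1.
  by move=> t1; rewrite -ler_norml -ler_sqr ?nnegrE // expr1n real_normK ?num_real.
by split; apply: sq_le1; apply: le_trans hab; rewrite ?lerDl ?lerDr sqr_ge0.
Qed.

Lemma truncn_eq_dist (x y : R) : 0 <= x -> 0 <= y -> Num.truncn x = Num.truncn y ->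
  (x - y) ^+ 2 <= 1.
Proof.
move=> x0 y0 E; have /andP[h1 h2] := truncn_itv x0; have /andP[h3 h4] := truncn_itv y0.
rewrite E in h1 h2; rewrite -natr1 in h2 h4.
move: (_%:R : R) h1 h2 h3 h4 => t *; nra.
Qed.

(* Pigeonhole on a grid for the real and imaginary parts of the entries. *)
Lemma card_near_lb (M : nat) (r : R) : 0 < r -> exists2 N : nat, (0 < N)%N &
  forall m, (m <= M)%N -> forall (gT : finGroupType) (tau : gT -> 'M[Cx]_m),
    (forall x y, tau (x * y)%g = tau x *m tau y) ->
    (forall x, (tau x)^t* *m tau x = 1%:M) ->
    (#|gT| <= N * #|[set x | (nsq (tau x - 1%:M) < r%:C)%R]|)%N.
Proof.
move=> r_gt0.
(* Cells have side 1/k, so matrices with the same code have squared distance at most 2 M^2/k^2 < r.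
   There are at most 2 M^2 real coordinates, each with 2k+1 cells. *)
pose k := (Num.truncn (2%:R * (M * M)%:R / r)).+1.
exists ((2 * k).+1 ^ (M * M * 2))%N => [|m mM gT tau tauM tauU]; first by rewrite expn_gt0.
set near := [set x | _].
pose part (b : bool) (z : Cx) : R := if b then complex.Re z else complex.Im z.
pose cell (x : R) := Num.truncn (k%:R * (x + 1)).
have entry x i j b : -1 <= part b (tau x i j) <= 1.
  by have [] := unitary_entry_le1 i j (mulmx1C (tauU x)); case: b.
have cell_lt x i j b : (cell (part b (tau x i j)) < (2 * k)%N.+1)%N.
  have /andP[h1 h2] := entry x i j b.
  have k_ge0 : 0 <= k%:R :> R by [].
  have x_ge0 : 0 <= k%:R * (part b (tau x i j) + 1) by rewrite mulr_ge0 //; lra.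
  rewrite /cell truncn_lt_nat // -natr1 natrM.
  have : k%:R * part b (tau x i j) <= k%:R * 1 by rewrite ler_wpM2l.
  lra.
pose code x : {ffun 'I_m * 'I_m * bool -> 'I_(2 * k)%N.+1} :=
  [ffun p => Ordinal (cell_lt x p.1.1 p.1.2 p.2)].
have fibre f : (#|[set x | code x == f]| <= #|near|)%N.
  have [->|[y]] := set_0Vmem [set x | code x == f]; first by rewrite cards0.
  rewrite inE => /eqP yf.
  rewrite -(card_rcoset _ y^-1) subset_leq_card //; apply/subsetP => x.
  rewrite mem_rcoset invgK !inE => /eqP; rewrite -yf => E.
  have -> : tau x - 1%:M = (tau (x * y)%g - tau y) *m (tau y)^t*.
    by rewrite mulmxBl -tauV // -!tauM mulgK mulgV tau1.
  rewrite nsq_mulr_iso ?trmxCK // -nsqRE ltcR.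
  have hij i j : complex.Re ((tau (x * y)%g - tau y) i j) ^+ 2 +
     complex.Im ((tau (x * y)%g - tau y) i j) ^+ 2 <= 2%:R / k%:R ^+ 2.
    have hp b : (part b (tau (x * y)%g i j) - part b (tau y i j)) ^+ 2 <= k%:R ^- 2.
      have /ffunP/(_ (i, j, b)) := E; rewrite !ffunE => /(congr1 val) /=.
      have /andP[h1 h2] := entry (x * y)%g i j b; have /andP[h3 h4] := entry y i j b.
      have k_gt0 : 0 < k%:R :> R by rewrite ltr0n.
      move=> /truncn_eq_dist h; rewrite -[leRHS]mul1r ler_pdivlMr ?exprn_gt0 //.
      apply: le_trans (h _ _); first by rewrite le_eqVlt; apply/orP; left; apply/eqP; ring.
        by rewrite mulr_ge0 //; lra.
      by rewrite mulr_ge0 //; lra.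
    rewrite !mxE !raddfB /= mulr_natl mulr2n.
    exact: lerD (hp true) (hp false).
  have k_gt : 2%:R * (M * M)%:R / r < k%:R by rewrite /k truncnS_gt.
  have k_ge1 : 1 <= k%:R :> R by rewrite ler1n.
  have mmMM : (m * m)%:R <= (M * M)%:R :> R by rewrite ler_nat leq_mul.
  have k2 : 0 < k%:R ^+ 2 :> R by rewrite exprn_gt0 // (lt_le_trans ltr01).
  apply: (@le_lt_trans _ _ ((m * m)%:R * (2%:R / k%:R ^+ 2))).
    rewrite natrM -mulrA mulr_natl -[X in _ *+ X]card_ord -sumr_const; apply: ler_sum => i _.
    by rewrite mulr_natl -[X in _ *+ X]card_ord -sumr_const; apply: ler_sum.
  rewrite mulrA ltr_pdivrMr // mulrC.
  move: k_gt; rewrite ltr_pdivrMr // => k_gt.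
  move: (k%:R : R) (_%:R : R) (_%:R : R) k_gt k_ge1 mmMM {k2} => t u w *; nra.
have -> : #|gT| = (\sum_f #|[set x | code x == f]|)%N.
  rewrite -cardsT -sum1_card (partition_big code xpredT) //=.
  apply: eq_bigr => f _; rewrite sum1dep_card; congr #|pred_of_set _|.
  by apply/setP => x; rewrite !inE.
apply: (@leq_trans (\sum_(f : {ffun 'I_m * 'I_m * bool -> 'I_(2 * k)%N.+1}) #|near|)%N).
  by apply: leq_sum => f _; exact: fibre.
rewrite sum_nat_const leq_mul2r; apply/orP; right.
rewrite card_ffun !card_prod !card_ord card_bool.
by rewrite leq_pexp2l // !leq_mul.
Qed.

End ComplexMatrices.

(** * The right regular representation and indicator vectors *)

Section RegularRepresentation.
Variables (C : numClosedFieldType) (gT : finGroupType).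

(** Oriented to act on row vectors, so that indicators move by right translation. *)
Definition regmx (x : gT) : 'M[C]_#|gT| :=
  \matrix_(i, j) (enum_val j == enum_val i * x)%g%:R.

Definition indic (A : {set gT}) : 'rV[C]_#|gT| := \row_i (enum_val i \in A)%:R.

Lemma sum_enum_val (f : gT -> C) : \sum_(i < #|gT|) f (enum_val i) = \sum_x f x.
Proof. by rewrite [RHS](reindex (fun i : 'I_#|gT| => enum_val i)) //=; apply: onW_bij; apply: enum_val_bij. Qed.

Lemma regmxM x y : regmx (x * y)%g = regmx x *m regmx y.
Proof.
apply/matrixP => i k; rewrite !mxE.
under eq_bigr => j _ do rewrite !mxE.
rewrite (sum_enum_val (fun z => (z == enum_val i * x)%g%:R * (enum_val k == z * y)%g%:R)).
rewrite (bigD1 (enum_val i * x)%g) //= eqxx mul1r big1 ?addr0 ?mulgA // => z /negbTE->.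
by rewrite mul0r.
Qed.

Lemma regmx1 : regmx 1 = 1%:M.
Proof. by apply/matrixP => i j; rewrite !mxE mulg1 (inj_eq enum_val_inj) eq_sym. Qed.

Lemma regmx_adj x : (regmx x)^t* = regmx x^-1.
Proof.
apply/matrixP => i j; rewrite !mxE conjC_nat; congr (_ %:R); congr (nat_of_bool _).
by apply/eqP/eqP => ->; rewrite ?mulgK ?mulgKV.
Qed.

Lemma regmx_unitary x : regmx x *m (regmx x)^t* = 1%:M.
Proof. by rewrite regmx_adj -regmxM mulgV regmx1. Qed.

Lemma indic_regmx (A : {set gT}) x : indic A *m regmx x = indic (A :* x)%g.
Proof.
apply/rowP => j; rewrite !mxE; under eq_bigr => i _ do rewrite !mxE.
rewrite (sum_enum_val (fun z => (z \in A)%:R * (enum_val j == z * x)%g%:R)).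
rewrite (bigD1 (enum_val j * x^-1)%g) //= mulgKV eqxx mulr1 mem_rcoset big1 ?addr0 // => z zj.
have -> : (enum_val j == z * x)%g = false; last by rewrite mulr0.
by apply: contraNF zj => /eqP->; rewrite mulgK.
Qed.

Lemma nsq_indicB (A B : {set gT}) : nsq (indic A - indic B) = #|symdiff A B|%:R.
Proof.
rewrite nsqE big_ord1; under eq_bigr => i _ do rewrite !mxE.
rewrite (sum_enum_val (fun z => `|(z \in A)%:R - (z \in B)%:R| ^+ 2)) -sum1_card natr_sum.
rewrite [RHS]big_mkcond /=; apply: eq_bigr => z _; rewrite !inE.
by case: (z \in A); case: (z \in B); rewrite /= ?subrr ?subr0 ?sub0r ?normrN ?normr1 ?normr0 ?expr1n ?expr0n.
Qed.

Lemma nsq_indic (A : {set gT}) : nsq (indic A) = #|A|%:R.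
Proof.
have <- : indic A - indic set0 = indic A.
  by apply/rowP => i; rewrite !mxE inE subr0.
by rewrite nsq_indicB /symdiff setD0 set0D setU0.
Qed.

End RegularRepresentation.

(** * A representation of bounded dimension controlling the almost-stabilizer *)

Section BohrInStabilizer.
Variable R : realType.
Local Notation Cx := (R[i])%type.

Lemma natC n : n%:R%:C = n%:R :> Cx.
Proof. by rewrite rmorph_nat. Qed.

Lemma natCM n (x : R) : (n%:R * x)%:C = n%:R * x%:C :> Cx.
Proof. by rewrite rmorphM /= natC. Qed.

(** This is [rep_approx] for the indicator of [A] in the regular representation, with [S] the
    almost-stabilizer at level eta/16, which is large by [card_Str_lb]. *)
Lemma bounded_rep_controls_Str (d : nat) (alpha eta : R) :
  0 < alpha -> 0 < eta -> eta < 1 ->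
  exists M : nat, forall (gT : finGroupType) (A : {set gT}),
    A != set0 -> (VCr A A <= d)%N -> #|A|%:R / #|gT|%:R = alpha ->
    exists (m : nat) (tau : gT -> 'M[Cx]_m),
    [/\ (0 < m <= M)%N, forall x y, tau (x * y)%g = tau x *m tau y,
       forall x, (tau x)^t* *m tau x = 1%:M &
       forall x, opnorm_lt (tau x - 1%:M) (eta / 2%:R) -> x \in Str eta A].
Proof.
move=> alpha_gt0 eta_gt0 eta_lt1.
have eta'_gt0 : 0 < eta / 16%:R by rewrite divr_gt0.
have [N N_gt0 hN] := card_Str_lb d alpha eta'_gt0.
(* The dimension is at most |G||A|/theta with theta = |S| (eta/16) |A|/4, and |A| <= N|S|. The
   successor leaves room for dimension 1. *)
exists (Num.truncn (4%:R * N%:R / (alpha * (eta / 16%:R)))).+1 => gT A A0 vcA alphaE.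
have A_gt0 : 0 < #|A|%:R :> R by rewrite ltr0n card_gt0.
have G_gt0 : 0 < #|gT|%:R :> R by rewrite ltr0n; apply/card_gt0P; exists 1%g.
pose S := Str (eta / 16%:R) A.
have AS : #|A|%:R <= N%:R * #|S|%:R :> R by rewrite -natrM ler_nat hN.
have S_gt0 : 0 < #|S|%:R :> R.
  by rewrite ltr0n lt0n; apply: contraTneq A_gt0 => E; rewrite E mulr0 in AS; rewrite -leNgt.
pose s := eta / 16%:R * #|A|%:R; pose theta := #|S|%:R * s / 4%:R.
have s_gt0 : 0 < s by rewrite mulr_gt0.
have theta_gt0 : 0 < theta by rewrite divr_gt0 // (mulr_gt0 S_gt0 s_gt0).
have [|||||m [tau [tauM tauU mtheta htau]]] := @rep_approx Cx gT _ (@regmx Cx gT)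
  (@regmxM Cx gT) (@regmx_unitary Cx gT) (indic Cx A) theta%:C s%:C S.
- by rewrite ltcR.
- by rewrite -card_gt0 -(ltr0n R).
- by rewrite ler0c ltW.
- move=> x; rewrite inE indic_regmx nsq_indicB -natC lecR; exact.
- by rewrite -!natC -!rmorphM lecR /= /theta [leLHS]mulrC divfK // pnatr_eq0.
have mM : (m <= Num.truncn (4%:R * N%:R / (alpha * (eta / 16%:R))))%N.
  have h : m%:R * theta <= #|gT|%:R * #|A|%:R :> R.
    by rewrite -lecR (natCM m) (natCM #|gT|) natC -nsq_indic.
  rewrite truncn_ge_nat; last by rewrite divr_ge0 ?mulr_ge0 ?invr_ge0 // ltW.
  rewrite ler_pdivlMr; last by rewrite (mulr_gt0 alpha_gt0 eta'_gt0).
  have E : #|A|%:R = alpha * #|gT|%:R by rewrite -alphaE divfK // gt_eqF.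
  have h1 : m%:R * (eta / 16%:R) * #|S|%:R <= 4%:R * #|gT|%:R.
    rewrite -(ler_pM2r A_gt0).
    have -> : m%:R * (eta / 16) * #|S|%:R * #|A|%:R = 4%:R * (m%:R * theta).
      by rewrite /theta /s; field.
    by rewrite -[leRHS]mulrA ler_pM2l.
  rewrite -(ler_pM2r G_gt0).
  have -> : m%:R * (alpha * (eta / 16)) * #|gT|%:R = m%:R * (eta / 16%:R) * #|A|%:R.
    by rewrite E; ring.
  have -> : 4%:R * N%:R * #|gT|%:R = N%:R * (4%:R * #|gT|%:R) :> R by ring.
  apply: le_trans (ler_wpM2l _ AS) _; first by rewrite mulr_ge0 // ltW.
  by rewrite mulrCA ler_wpM2l.
have key x : opnorm_lt (tau x - 1%:M) (eta / 2%:R) -> x \in Str eta A.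
  move=> hx; have [c [c0 cd hc]] := (opnorm_ltE _ _).1 hx.
  have c2_ge0 : 0 <= (c ^+ 2)%:C :> Cx by rewrite ler0c exprn_ge0.
  have h : #|symdiff (A :* x)%g A|%:R <= 8%:R * s + 2%:R * (c ^+ 2 * #|A|%:R).
    have := htau x _ c2_ge0 hc; rewrite indic_regmx nsq_indicB nsq_indic.
    by rewrite -lecR rmorphD /= (natCM 8) (natCM 2) [(c ^+ 2 * _)%:C]rmorphM /= !natC.
  rewrite inE; apply: le_trans h _; rewrite /s /=.
  (* As c < eta/2 and eta < 1, the total 8 (eta/16) + 2 c^2 is at most eta/2 + eta/2. *)
  have cc : c ^+ 2 <= eta / 4%:R by rewrite expr2; nra.
  have : c ^+ 2 * #|A|%:R <= eta / 4%:R * #|A|%:R by rewrite ler_pM2r.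
  move: (c ^+ 2 * _) => w; lra.
(* A zero-dimensional compression is replaced by the trivial character; [key] then puts every x in
   the almost-stabilizer. *)
have [m0|m_gt0] := posnP m; last by exists m, tau; split=> //; rewrite m_gt0 ltnW.
exists 1, (fun _ => 1%:M); split=> // [x y|x|x _].
- by rewrite mulmx1.
- by rewrite trmx1 map_mx1 mulmx1.
apply: key; rewrite (_ : tau x - 1%:M = 0); last first.
  apply/matrixP => -[i i_lt] j; have : (i < 0)%N by rewrite -[X in (_ < X)%N]m0.
  by [].
by apply: opnorm_lt0; rewrite divr_gt0.
Qed.

End BohrInStabilizer.

(** The number of distinct values depends only on the fibres; [index_tau] uses this to trade
    matrices for cosets. *)
Lemma size_undup_map (T : eqType) (U V : eqType) (f : T -> U) (g : T -> V) (s : seq T) :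
  (forall x y, (f x == f y) = (g x == g y)) ->
  size (undup [seq f x | x <- s]) = size (undup [seq g x | x <- s]).
Proof.
move=> fg; elim: s => //= x s IH.
have -> : (f x \in [seq f z | z <- s]) = (g x \in [seq g z | z <- s]).
  by apply/mapP/mapP => -[y ys /eqP E]; exists y => //; apply/eqP; rewrite ?fg // -fg.
by case: ifP => _ //=; rewrite IH.
Qed.

Lemma size_undup_card (T V : finType) (g : T -> V) (A : {set T}) :
  size (undup [seq g x | x <- enum A]) = #|[set g x | x in A]|.
Proof.
rewrite -(card_uniqP (undup_uniq _)); apply: eq_card => y.
rewrite mem_undup; apply/mapP/imsetP => -[x xA ->]; exists x => //;
by rewrite mem_enum in xA *.
Qed.

Section BohrSets.
Variables (R : realType) (gT : finGroupType) (m : nat).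
Local Notation Cx := (R[i])%type.
Variable tau : gT -> 'M[Cx]_m.
Variable K : {group gT}.
Hypothesis tauM : forall x y, tau (x * y)%g = tau x *m tau y.
Hypothesis tauU : forall x, (tau x)^t* *m tau x = 1%:M.
Hypothesis Knormal : (K <| [set: gT])%g.
Hypothesis Kdiag : forall x, x \in K -> is_diag_mx (tau x).
Hypothesis Kker : forall x, tau x = 1%:M -> x \in K.

(** [K] lives in the group rather than in the image of [tau]; since it contains the kernel, it is
    the full preimage of its image, which matches the required form of a Bohr neighborhood. *)
Definition bohr (r : R) : {set gT} := [set x in K | `[< opnorm_lt (tau x - 1%:M) r >]].

Lemma bohrP r x : reflect (x \in K /\ opnorm_lt (tau x - 1%:M) r) (x \in bohr r).
Proof. by rewrite inE; apply: (iffP andP) => -[xK /asboolP]. Qed.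

Lemma bohr1 r : 0 < r -> 1%g \in bohr r.
Proof.
move=> r_gt0; apply/bohrP; rewrite group1 tau1 // subrr; split=> //.
exact: opnorm_lt0.
Qed.

Lemma bohrV r x : x \in bohr r -> (x^-1)%g \in bohr r.
Proof.
by move=> /bohrP[xK xr]; apply/bohrP; rewrite groupV; split=> //; apply: opnorm_lt_tauV.
Qed.

Lemma bohrM r s x y : x \in bohr r -> y \in bohr s -> (x * y)%g \in bohr (r + s).
Proof.
move=> /bohrP[xK xr] /bohrP[yK ys]; apply/bohrP.
by split; [exact: groupM|apply: opnorm_lt_tauM].
Qed.

Lemma bohrS r s : r <= s -> bohr r \subset bohr s.
Proof.
move=> rs; apply/subsetP => x /bohrP[xK xr]; apply/bohrP; split=> //.
exact: opnorm_lt_le xr.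
Qed.

Lemma tau_inj_mod_ker x y : tau x = tau y -> (x * y^-1)%g \in K.
Proof. by move=> E; apply: Kker; rewrite tauM E -tauM mulgV tau1. Qed.

(** The distinct images of a subgroup correspond to cosets of the kernel [L], so the claim is
    multiplicativity of the index. *)
Lemma index_tau :
  size (undup [seq tau x | x <- enum gT]) =
  (#|[set: gT] : K|%g * size (undup [seq tau x | x <- enum gT & x \in K]))%N.
Proof.
have gL : group_set [set x | tau x == 1%:M].
  apply/group_setP; split=> [|x y]; rewrite !inE ?tau1 //.
  by move=> /eqP xE /eqP yE; rewrite tauM xE yE mulmx1.
pose L := Group gL.
have LE x y : (tau x == tau y) = ((L :* x)%g == (L :* y)%g).
  apply/eqP/eqP => [E|E].
    by apply/rcoset_eqP; rewrite mem_rcoset inE tauM E -tauM mulgV tau1.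
  have := rcoset_refl L x; rewrite E mem_rcoset inE tauM => /eqP h.
  have := congr1 (mulmx^~ (tau y)) h.
  by rewrite mul1mx -mulmxA -tauM mulVg tau1 // mulmx1.
have sz (H : {group gT}) : size (undup [seq tau x | x <- enum H]) = #|H : L|%g.
  rewrite (size_undup_map _ LE) size_undup_card /indexg /rcosets; congr #|pred_of_set _|.
  by apply/setP => X; apply/imsetP/imsetP => -[x xH ->]; exists x => //; rewrite rcosetE.
have -> : enum gT = enum [set: gT]%G by apply: eq_enum => x; rewrite !inE.
have -> : [seq x <- enum [set: gT]%G | x \in K] = enum K.
  by rewrite /enum_mem -filter_predI; apply: eq_filter => x; rewrite !inE andbT.
rewrite !sz Lagrange_index ?subsetT //.
by apply/subsetP => x; rewrite inE => /eqP; apply: Kker.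
Qed.

Lemma bohr_is_bohr_nbhd r : 0 < r -> r < 1 -> (0 < m)%N ->
  bohr_nbhd r m #|[set: gT] : K|%g (bohr r).
Proof.
move=> r_gt0 r_lt1 m_gt0; split=> //.
pose KM (M : 'M[Cx]_m) := [exists x in K, tau x == M].
have KMP M : reflect (exists2 x, x \in K & tau x = M) (KM M).
  by apply: (iffP exists_inP) => -[x xK /eqP]; exists x.
have KMtau x : KM (tau x) = (x \in K).
  apply/KMP/idP => [[y yK /tau_inj_mod_ker]|xK]; last by exists x.
  by rewrite groupMl // groupV.
have inv_tau x : invmx (tau x) = tau x^-1%g.
  rewrite tauV // invmx_unitary //; apply/unitarymxP; exact: mulmx1C.
exists tau, KM; split; first by move=> x; rewrite /unitary adjmxE.
split; first exact: tauM.
split; first by move=> M /KMP[x _ <-]; exists x.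
split; first by rewrite -(tau1 tauM tauU) KMtau.
split; first by move=> _ _ /KMP[x xK <-] /KMP[y yK <-]; rewrite -tauM KMtau groupM.
split; first by move=> _ /KMP[x xK <-]; rewrite inv_tau KMtau groupV.
split.
  move=> x _ /KMP[y yK <-]; rewrite inv_tau -!tauM KMtau -mulgA -/(conjg y x).
  by rewrite memJ_norm // (subsetP (normal_norm Knormal)) ?inE.
split.
  by rewrite index_tau; congr (_ * size (undup (map tau _)))%N; apply: eq_filter => x; rewrite KMtau.
split; first by move=> _ /KMP[x xK <-]; apply: Kdiag.
by move=> x; rewrite KMtau; split=> [/bohrP|/bohrP].
Qed.

End BohrSets.

(** Growth by more than a factor 2 at every step would give 2^L <= L. *)
Lemma nondoubling_step (f : nat -> nat) (L : nat) :
  (0 < f 0)%N -> (f L <= L * f 0)%N ->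
  exists2 j, (j < L)%N & (f j.+1 <= 2 * f j)%N.
Proof.
move=> f0 fL; apply: contrapT => h.
have {}h j : (j < L)%N -> (2 * f j < f j.+1)%N.
  by move=> jL; rewrite ltnNge; apply/negP => hj; apply: h; exists j.
have grow j : (j <= L)%N -> (2 ^ j * f 0 <= f j)%N.
  elim: j => [|j IH] jL; first by rewrite mul1n.
  have := h j jL; have := IH (ltnW jL); rewrite expnS -mulnA; lia.
have : (2 ^ L * f 0 <= L * f 0)%N := leq_trans (grow L (leqnn L)) fL.
by rewrite leq_pmul2r // leqNgt ltn_expl.
Qed.

Section Diagonalization.
Variables (R : realType) (gT : finGroupType) (m : nat).
Local Notation Cx := (R[i])%type.

(** Conjugating by the basis from [jordan] makes the image of [K] literally diagonal and changes no
    norm. *)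
Lemma diagonal_rep (tau : gT -> 'M[Cx]_m) :
  (forall x y, tau (x * y)%g = tau x *m tau y) ->
  (forall x, (tau x)^t* *m tau x = 1%:M) ->
  exists (sigma : gT -> 'M[Cx]_m) (K : {group gT}),
  [/\ (forall x y, sigma (x * y)%g = sigma x *m sigma y) /\
      (forall x, (sigma x)^t* *m sigma x = 1%:M),
     (K <| [set: gT])%g,
     (forall x, x \in K -> is_diag_mx (sigma x)),
     [set x | nsq (sigma x - 1%:M) < (4%:R^-1)%:C] \subset K &
     forall x r, opnorm_lt (sigma x - 1%:M) r -> opnorm_lt (tau x - 1%:M) r].
Proof.
move=> tauM tauU.
have [P Pu diag] := jordan tauM tauU.
have PP : P *m P^t* = 1%:M by apply/unitarymxP.
have PP' := mulmx1C PP.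
pose sigma x := P *m tau x *m P^t*.
have sE x : sigma x - 1%:M = P *m (tau x - 1%:M) *m P^t*.
  by rewrite mulmxBr mulmxBl mulmx1 PP.
exists sigma, <<near1 tau>>%G; split.
- split=> [x y|x].
    by rewrite /sigma tauM !mulmxA -[_ *m P^t* *m P]mulmxA PP' mulmx1.
  rewrite /sigma !adjM trmxCK -!mulmxA (mulmxA _ P) PP' mul1mx.
  by rewrite (mulmxA _ (tau x)) tauU mul1mx PP.
- exact: near1_gen_normal.
- exact: diag.
- apply: subset_trans (subset_gen _); apply/subsetP => x; rewrite !inE sE.
  rewrite nsq_mulr_iso ?trmxCK // nsq_mull_iso // rmorphV ?unitfE ?pnatr_eq0 //=.
  by rewrite natC.
move=> x r hx; have [c [c0 cr hc]] := (opnorm_ltE _ _).1 hx.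
apply: (opnorm_ltE _ _).2; exists c; split; [exact: c0|exact: cr|move=> v].
have -> : tau x - 1%:M = P^t* *m (sigma x - 1%:M) *m P.
  by rewrite sE !mulmxA PP' mul1mx -mulmxA PP' mulmx1.
rewrite -!mulmxA nsq_mull_iso ?trmxCK //.
by apply: le_trans (hc _) _; rewrite nsq_mull_iso.
Qed.

End Diagonalization.

(** * Choice of parameters and final assembly *)

Section Main.
Variable R : realType.
Local Notation Cx := (R[i])%type.

Lemma bohr_regularity (d : nat) (alpha eps : R) :
  0 < alpha -> 0 < eps -> eps < 1 ->
  exists c : R, forall (gT : finGroupType) (A : {set gT}),
    A != set0 -> (VCr A A <= d)%N -> #|A|%:R / #|gT|%:R = alpha ->
    exists B : {set gT},
      [/\ (exists (delta : R) (m n : nat),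
             bohr_nbhd delta m n B /\ complexity_le delta m n c),
          B \subset Str eps A,
          (exists2 F : {set gT}, F \subset A &
             #|F|%:R <= c /\
             (#|symdiff A (F * B)%g|%:R < eps * #|A|%:R))
        & (#|Zl eps A B|%:R <= eps * #|A|%:R)].
Proof.
move=> alpha_gt0 eps_gt0 eps_lt1.
(* Structure needs 6 eta < eps and regularity needs eta <= eps^3. *)
pose eta := eps ^+ 3 / 7%:R.
have e2_gt0 : 0 < eps ^+ 2 by rewrite exprn_gt0.
have e2_lt1 : eps ^+ 2 < 1 by rewrite exprn_ilt1 // ltW.
have e3 : eps ^+ 3 = eps ^+ 2 * eps by rewrite exprSr.
have e3_gt0 : 0 < eps ^+ 3 by rewrite exprn_gt0.
have e3_lt : eps ^+ 3 < eps by rewrite e3 gtr_pMl.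
have eta_gt0 : 0 < eta by rewrite /eta; lra.
have eta_lt1 : eta < 1 by rewrite /eta; lra.
have eta_le : eta <= eps by rewrite /eta; lra.
have [M hM] := bounded_rep_controls_Str d alpha_gt0 eta_gt0 eta_lt1.
pose delta0 := eta / 2%:R.
have d0_gt0 : 0 < delta0 by rewrite /delta0; lra.
have d0_lt : delta0 < 2%:R^-1 by rewrite /delta0; lra.
have sq_gt0 (t : R) : 0 < t -> 0 < t ^+ 2 by move=> ?; rewrite exprn_gt0.
have half_gt0 (t : R) : 0 < t -> 0 < t / 2%:R by move=> ?; lra.
(* [N2] will bound the index of [K], [L] the ratio of |G| to the Bohr set of radius delta0/2, and
   [N4] the size of [F]. *)
have [N2 N2_gt0 hN2] := @card_near_lb R M (4%:R^-1) (ltac:(by rewrite invr_gt0)).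
have [L L_gt0 hL] := card_near_lb M (sq_gt0 _ (half_gt0 _ d0_gt0)).
(* [L] steps of length [kappa] lead from radius delta0/2 to delta0, so [L] is both the number of
   steps and the growth bound in [nondoubling_step]. *)
pose kappa := delta0 / 2%:R / L%:R.
have LR_gt0 : 0 < L%:R :> R by rewrite ltr0n.
have k_gt0 : 0 < kappa by rewrite divr_gt0 // half_gt0.
have LkE : L%:R * kappa = delta0 / 2%:R by rewrite /kappa mulrC divfK ?gt_eqF.
have k_le : kappa <= delta0 / 2%:R by rewrite -LkE ler_peMl ?ler1n // ltW.
have [N4 N4_gt0 hN4] := card_near_lb M (sq_gt0 _ (half_gt0 _ k_gt0)).
exists (kappa^-1 + M%:R + N2%:R + N4%:R) => gT A A0 vcA alphaE.
have [m [tau [/andP[m_gt0 mM] tauM tauU tauStr]]] := hM gT A A0 vcA alphaE.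
have [sigma [K [[sM sU] Kn Kdiag Knear sop]]] := diagonal_rep tauM tauU.
have A_gt0 : 0 < #|A|%:R :> R by rewrite ltr0n card_gt0.
pose B := bohr sigma K.
have BStr r x : r <= delta0 -> x \in B r -> x \in Str eta A.
  move=> rd /bohrP[_ xr]; apply: tauStr; apply: sop.
  exact: opnorm_lt_le xr.
(* Up to radius 1/2 the Frobenius ball lies in [K], hence in the Bohr set of the same radius. *)
have near_B r : 0 < r -> r <= 2%:R^-1 ->
    (#|[set x | (nsq (sigma x - 1%:M) < (r ^+ 2)%:C)%R]| <= #|B r|)%N.
  move=> r_gt0 r_le; apply: subset_leq_card; apply/subsetP => x; rewrite inE => xr.
  apply/bohrP; split; last exact: opnorm_lt_nsq.
  apply: (subsetP Knear); rewrite inE; apply: lt_le_trans xr _; rewrite lecR.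
  have -> : 4%:R^-1 = 2%:R^-1 ^+ 2 :> R by field.
  by rewrite ler_sqr ?nnegrE ?invr_ge0 // ltW.
have Kker x : sigma x = 1%:M -> x \in K.
  move=> E; apply: (subsetP Knear); rewrite inE E subrr -nsqRE ltcR.
  rewrite (_ : nsqR 0 = 0) ?invr_gt0 //.
  by apply: big1 => i _; apply: big1 => j _; rewrite !mxE /= expr0n addr0.
have indexK : (#|[set: gT] : K|%g <= N2)%N.
  have KG : K \subset [set: gT] by apply: subsetT.
  rewrite -(leq_pmul2l (cardG_gt0 K)) Lagrange // cardsT mulnC.
  apply: leq_trans (hN2 m mM gT sigma sM sU) _.
  by rewrite leq_mul2l subset_leq_card ?orbT.
pose r j := delta0 / 2%:R + j%:R * kappa.
have r_gt0 j : 0 < r j.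
  by rewrite /r ltr_pwDl ?half_gt0 // mulr_ge0 // ltW.
have rS j : r j.+1 = kappa + r j by rewrite /r -natr1; ring.
have r_le j : (j <= L)%N -> r j <= delta0.
  move=> jL; rewrite /r [leRHS](_ : _ = delta0 / 2%:R + delta0 / 2%:R); last by field.
  by rewrite -{3}LkE lerD2l ler_pM2r // ler_nat.
have [j jL dbl] : exists2 j, (j < L)%N & (#|B (r j.+1)| <= 2 * #|B (r j)|)%N.
  apply: (@nondoubling_step (fun j => #|B (r j)|)).
    by apply/card_gt0P; exists 1%g; apply: bohr1.
  apply: leq_trans (max_card _) _.
  apply: leq_trans (hL m mM gT sigma sM sU) _; rewrite leq_mul2l; apply/orP; right.
  rewrite /r mul0r addr0; apply: near_B; first exact: half_gt0.
  by lra.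
have k2 : kappa / 2%:R + kappa / 2%:R = kappa by field.
have k_d0 : kappa <= delta0 by lra.
exists (B kappa); split.
- exists kappa, m, #|[set: gT] : K|%g; split.
    by apply: bohr_is_bohr_nbhd => //; lra.
  have M0 : 0 <= M%:R :> R by []. have N20 : 0 <= N2%:R :> R by [].
  have N40 : 0 <= N4%:R :> R by []. have k0 : 0 <= kappa^-1 by rewrite invr_ge0 ltW.
  have mMR : m%:R <= M%:R :> R by rewrite ler_nat.
  have nR : #|[set: gT] : K|%g%:R <= N2%:R :> R by rewrite ler_nat.
  by clear -mMR nR M0 N20 N40 k0; split; lra.
- apply/subsetP => x /(BStr _ _ k_d0); rewrite !inE => /le_trans; apply.
  by rewrite ler_pM2r.
- have [||||||F FA [cF hF]] := @bohr_structure R gT A eta (B kappa) (B (r j)) (B (r j.+1)) (B (kappa / 2%:R)).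
  + exact/bohr1/half_gt0.
  + by apply/set0Pn; exists 1%g; apply: bohr1.
  + exact: dbl.
  + by move=> x y xB yB; rewrite -k2; apply: bohrM => //; apply: bohrV.
  + by move=> x y xB yB; rewrite rS; apply: bohrM.
  + move=> x /setUP xB; apply: (BStr (r j.+1)); first exact: r_le.
    apply: bohrV => //; case: xB => //; apply: (subsetP (bohrS _ _ _)).
    by rewrite rS lerDr ltW.
  exists F => //; split.
    have cFN : (#|F| <= N4)%N.
      have Bh_gt0 : (0 < #|B (kappa / 2%:R)|)%N.
        by apply/card_gt0P; exists 1%g; apply/bohr1/half_gt0.
      rewrite -(leq_pmul2r Bh_gt0); apply: leq_trans cF _.
      apply: leq_trans (hN4 m mM gT sigma sM sU) _; rewrite leq_mul2l; apply/orP; right.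
      by apply: near_B; [exact: half_gt0|lra].
    have cFR : #|F|%:R <= N4%:R :> R by rewrite ler_nat.
    have M0 : 0 <= M%:R :> R by []. have N20 : 0 <= N2%:R :> R by [].
    have k0 : 0 <= kappa^-1 by rewrite invr_ge0 ltW.
    by clear -cFR M0 N20 k0; lra.
  apply: le_lt_trans hF _; rewrite mulrA ltr_pM2r // /eta; lra.
have hZ := @card_Zl_le R gT A eta eps (B kappa) eps_gt0.
have {}hZ : eps ^+ 2 * #|Zl eps A (B kappa)|%:R <= eta * #|A|%:R.
  apply: hZ; first by apply/set0Pn; exists 1%g; apply: bohr1.
  (* The quotient lies in the Bohr set of radius 2 kappa <= delta0. *)
  move=> b c bB cB; apply: (BStr (kappa + kappa)); first lra.
  by apply: bohrM => //; apply: bohrV.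
rewrite -(ler_pM2l e2_gt0); apply: le_trans hZ _.
by rewrite mulrA -e3 ler_pM2r // /eta; lra.
Qed.

End Main.

(* O_{d,alpha,eps}(1): a single bound function C(d, alpha, eps), chosen
   before G and A, bounds the complexity and |F|. *)
Theorem theorem4p1 (R : realType) :
  exists C : nat -> R -> R -> R,
  forall (gT : finGroupType) (A : {set gT}) (eps : R),
    A != set0 -> 0 < eps -> eps < 1 ->
    let d := maxn (VCl A A) (VCr A A) in
    let alpha : R := #|A|%:R / #|gT|%:R in
    exists B : {set gT},
      [/\ (exists (delta : R) (m n : nat),
             bohr_nbhd delta m n B /\ complexity_le delta m n (C d alpha eps)),
          B \subset Str eps A,
          (exists2 F : {set gT}, F \subset A &
             #|F|%:R <= C d alpha eps /\
             (#|symdiff A (F * B)%g|%:R < eps * #|A|%:R))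
        & (#|Zl eps A B|%:R <= eps * #|A|%:R)].
Proof.
(* The bounds for fixed parameters become one function of the triple (d, alpha, eps) by choice. *)
pose good (p : nat * R * R) (c : R) := 0 < p.1.2 -> 0 < p.2 -> p.2 < 1 ->
  forall (gT : finGroupType) (A : {set gT}),
    A != set0 -> (VCr A A <= p.1.1)%N -> #|A|%:R / #|gT|%:R = p.1.2 ->
    exists B : {set gT},
      [/\ (exists (delta : R) (m n : nat),
             bohr_nbhd delta m n B /\ complexity_le delta m n c),
          B \subset Str p.2 A,
          (exists2 F : {set gT}, F \subset A &
             #|F|%:R <= c /\ (#|symdiff A (F * B)%g|%:R < p.2 * #|A|%:R))
        & (#|Zl p.2 A B|%:R <= p.2 * #|A|%:R)].
have [f hf] : {f & forall p, good p (f p)}.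
  apply: choice => -[[d alpha] eps].
  have [/andP[a0 /andP[e0 e1]]|h] := boolP [&& 0 < alpha, 0 < eps & eps < 1].
    have [c hc] := bohr_regularity d a0 e0 e1.
    by exists c => _ _ _; apply: hc.
  (* Outside the admissible range [good] is vacuous, and 0 is a default value. *)
  by exists 0 => a0 e0 e1; rewrite a0 e0 e1 in h.
exists (fun d alpha eps => f (d, alpha, eps)) => gT A eps A0 e0 e1 d alpha.
apply: (hf (d, alpha, eps)) => //=; last exact: leq_maxr.
by rewrite divr_gt0 // ltr0n ?card_gt0 //; apply/card_gt0P; exists 1%g.
Qed.
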